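(* Let $d\ge2$ and $p\in[1,1+4/(d-2))$ (with $1+4/(d-2)=\infty$ if $d=2$). Let $\Omega=(\Omega_1,\dots,\Omega_{[d/2]})\in\mathbb{R}^{[d/2]}$ and $\gamma=(\gamma_1,\dots,\gamma_d)\in\mathbb{R}^d$. Let $A(x)=Mx$, where $M=M_d(\Omega)$ is the anti-symmetric matrix described in the context, let $L_A=iA\cdot\nabla$, and let $$V_\gamma(x)=\frac12\sum_{j=1}^d\epsilon_j\gamma_j^2x_j^2,\qquad \epsilon_j=\operatorname{sgn}(\gamma_j).$$ Let $N:\mathbb{R}^d\times\mathbb{C}\to\mathbb{C}$ be continuous with $|N(x,v)|\le C_0(|v|+|v|^p)$ for all $x,v$ and some constant $C_0>0$. Suppose that either of the following conditions holds: (a) $|\Omega_{k_0}|>\min(\gamma_{2k_0-1},\gamma_{2k_0})$ for some $1\le k_0\le[d/2]$; (b) $\gamma_{j_0}<0$ for some $1\le j_0\le d$. Then there exists no ground state solution for $$-\tfrac12\Delta u+V_\gamma(x)u+N(x,u)+L_Au=-\lambda u,\qquad\|u\|_2=1;$$ that is, there is no $u\in S_1$ with $E_{\Omega,\gamma}(u)=I_1$.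
   Context: $[d/2]$ is the integer part of $d/2$. With $\sigma=\begin{pmatrix}0&-1\\1&0\end{pmatrix}$, $M_d(\Omega)$ is the $d\times d$ block-diagonal matrix with diagonal blocks $\Omega_1\sigma,\dots,\Omega_{[d/2]}\sigma$, followed by a single zero last diagonal entry if $d$ is odd. The nonlinearity is of the form $N(x,u)=G'(x,|u|^2)u$, where $G(x,|u|^2)=2\int_0^{|u|}N(x,s)\,ds$ is real-valued and $G'(x,z)=\partial_zG(x,z)$. In magnetic form the equation reads $-\frac12(\nabla-iA)^2u+V(x)u+N(x,u)=-\lambda u$ with $V(x)=V_\gamma(x)-\frac{|A(x)|^2}{2}$. $\Sigma$ is the space of $u:\mathbb{R}^d\to\mathbb{C}$ with finite norm $\|u\|_\Sigma=\left(\int|\nabla u|^2+(1+|A|^2+|V|)|u|^2dx\right)^{1/2}$. The energy is $$E_{\Omega,\gamma}(u)=\int\left(\tfrac12|(\nabla-iA)u|^2+V|u|^2+G(x,|u|^2)\right)dx=\tfrac12\int|\nabla u|^2+\int V_\gamma|u|^2+\int G(x,|u|^2)+\int\bar u\,L_Au.$$ $S_1=\{u\in\Sigma:\int|u|^2dx=1\}$ and $I_1=\inf\{E_{\Omega,\gamma}(u):u\in S_1\}\in[-\infty,\infty)$. A ground state solution is an element $u\in S_1$ with $E_{\Omega,\gamma}(u)=I_1$. *)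

(* Defs.v *)
From HB Require Import structures.
From mathcomp Require Import all_boot all_order all_algebra.
From mathcomp Require Import complex.
From mathcomp Require Import all_classical all_reals all_analysis.

Set Implicit Arguments.
Unset Strict Implicit.
Unset Printing Implicit Defensive.

Import Order.TTheory GRing.Theory Num.Theory.
Import numFieldNormedType.Exports Normc.

Local Open Scope classical_set_scope.
Local Open Scope ring_scope.
Local Open Scope complex_scope.

Section LebesgueTuple.
Context {R : realType}.

Definition tuple_cons n (p : R * n.-tuple R) : n.+1.-tuple R :=
  [tuple of p.1 :: p.2].

Definition tuple_uncons n (t : n.+1.-tuple R) : R * n.-tuple R :=
  (thead t, [tuple of behead t]).

Lemma measurable_tuple_cons n : measurable_fun setT (@tuple_cons n).
Proof. exact: measurable_cons. Qed.

Lemma measurable_tuple_uncons n : measurable_fun setT (@tuple_uncons n).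
Proof.
apply/measurable_fun_pairP; split.
  by apply: (@measurable_tnth _ _ _ ord0).
exact: measurable_behead.
Qed.

Lemma tuple_consK n : cancel (@tuple_cons n) (@tuple_uncons n).
Proof. by case=> x t; congr (_, _); apply/val_inj. Qed.

Lemma tuple_unconsK n : cancel (@tuple_uncons n) (@tuple_cons n).
Proof. by move=> t; rewrite /tuple_cons/= -tuple_eta. Qed.

(* The generic measure instance on pushforward takes a measurability proof that
   is not found by inference, so the instances are built here for lebesgue_cons
   and, below, for lebesgue_col. *)
Section lebesgue_cons.
Local Open Scope ereal_scope.
Variables (n : nat) (m : {sigma_finite_measure set (n.-tuple R) -> \bar R}).

Definition lebesgue_cons : set (n.+1.-tuple R) -> \bar R :=
  pushforward (lebesgue_measure \x m) (@tuple_cons n).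

Let lebesgue_cons0 : lebesgue_cons set0 = 0.
Proof. by rewrite /lebesgue_cons /pushforward preimage_set0 measure0. Qed.

Let lebesgue_cons_ge0 A : 0 <= lebesgue_cons A.
Proof. exact: (measure_ge0 (lebesgue_measure \x m)). Qed.

Let lebesgue_cons_sigma_additive : semi_sigma_additive lebesgue_cons.
Proof.
have mf := @measurable_tuple_cons n.
move=> F mF tF mUF; rewrite /lebesgue_cons /pushforward preimage_bigcup.
apply: (@measure_semi_sigma_additive _ _ _ (lebesgue_measure \x m)).
- by move=> k; rewrite -[X in measurable X]setTI; exact: mf.
- apply/trivIsetP => /= i j _ _ ij; rewrite -preimage_setI.
  by move/trivIsetP : tF => /(_ _ _ _ _ ij) ->//; rewrite preimage_set0.
- by rewrite -preimage_bigcup -[X in measurable X]setTI; exact: mf.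
Qed.

HB.instance Definition _ := isMeasure.Build _ _ _ lebesgue_cons
  lebesgue_cons0 lebesgue_cons_ge0 lebesgue_cons_sigma_additive.

Let lebesgue_cons_sigma_finite : sigma_finite setT lebesgue_cons.
Proof.
have /sigma_finiteP[F [FT ndF Foo]] := sigma_finiteT (@lebesgue_measure R).
have /sigma_finiteP[G [GT ndG Goo]] := sigma_finiteT m.
exists (fun k => @tuple_uncons n @^-1` (F k `*` G k)).
  apply/esym; rewrite -subTset => t _.
  have [i _ Fi] : (\bigcup_i F i) (tuple_uncons t).1 by rewrite -FT.
  have [j _ Gj] : (\bigcup_i G i) (tuple_uncons t).2 by rewrite -GT.
  exists (maxn i j) => //; split.
    by move: Fi; exact/subsetPset/ndF/leq_maxl.
  by move: Gj; exact/subsetPset/ndG/leq_maxr.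
move=> k; have [mF Fk] := Foo k; have [mG Gk] := Goo k; split.
  rewrite -[X in measurable X]setTI.
  by apply: measurable_tuple_uncons => //; exact: measurableX.
rewrite /lebesgue_cons /pushforward -comp_preimage.
rewrite (_ : _ \o _ = id); last by apply/funext => p /=; rewrite tuple_consK.
rewrite preimage_id product_measure1E// lte_mul_pinfty//.
by rewrite ge0_fin_numE.
Qed.

HB.instance Definition _ := Measure_isSigmaFinite.Build _ _ _ lebesgue_cons
  lebesgue_cons_sigma_finite.

End lebesgue_cons.

Fixpoint lebesgue_tuple n : {sigma_finite_measure set (n.-tuple R) -> \bar R} :=
  if n is n'.+1 then lebesgue_cons (lebesgue_tuple n')
  else \d_([tuple] : 0.-tuple R).

Lemma measurable_tuple_box n (A : 'I_n -> set R) :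
  (forall i, measurable (A i)) ->
  measurable [set t : n.-tuple R | forall i, A i (tnth t i)].
Proof.
move=> mA; have -> : [set t : n.-tuple R | forall i, A i (tnth t i)] =
    \bigcap_(i in setT) ((@tnth n R ^~ i) @^-1` A i).
  by apply/seteqP; split=> t /= At i => [_|]; exact: At.
apply: fin_bigcap_measurable; first exact: finite_finset.
move=> i _.
by rewrite -[X in measurable X]setTI; apply: (measurable_tnth i) => //; exact: mA.
Qed.

Lemma lebesgue_tuple_box n (A : 'I_n -> set R) :
  (forall i, measurable (A i)) ->
  lebesgue_tuple n [set t | forall i, A i (tnth t i)] =
  (\prod_(i < n) lebesgue_measure (A i))%E.
Proof.
elim: n A => [|n IHn] A mA.
  by rewrite big_ord0 /= diracE mem_set//= => -[].
have mA' i : measurable (A (lift ord0 i)) by exact: mA.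
rewrite big_ord_recl -(IHn (fun i => A (lift ord0 i)) mA').
rewrite -product_measure1E//; [|exact: (mA ord0)|exact: measurable_tuple_box mA'].
rewrite /= /lebesgue_cons /pushforward; congr (product_measure1 _ _ _).
apply/seteqP; split=> -[x t] /= At.
  split=> [|i]; first by have := At ord0; rewrite /tnth.
  by have := At (lift ord0 i); rewrite /tuple_cons tnthS.
case: At => Ax At i; case: (unliftP ord0 i) => [j ->|->].
  by rewrite /tuple_cons tnthS; exact: At.
by rewrite /tnth.
Qed.

End LebesgueTuple.

Section MeasurableCol.
Variables (R : realType) (d : nat).

Let coords : 'I_d -> 'cV[R]_d -> R := fun i x => x i 0.

Let cV_set0 : g_sigma_preimage coords set0.
Proof. exact: sigma_algebra0. Qed.

Let cV_setC A : g_sigma_preimage coords A -> g_sigma_preimage coords (~` A).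
Proof. exact: sigma_algebraC. Qed.

Let cV_bigcup (F : (set 'cV[R]_d)^nat) :
  (forall i, g_sigma_preimage coords (F i)) ->
  g_sigma_preimage coords (\bigcup_i (F i)).
Proof. exact: sigma_algebra_bigcup. Qed.

HB.instance Definition _ :=
  @isMeasurable.Build default_measure_display
    'cV[R]_d (g_sigma_preimage coords) cV_set0 cV_setC cV_bigcup.

Definition col_of_tuple (t : d.-tuple R) : 'cV[R]_d := \col_i tnth t i.

Lemma measurable_col_of_tuple : measurable_fun setT col_of_tuple.
Proof.
apply: (measurability (\big[setU/set0]_(i < d)
  preimage_set_system setT (coords i) measurable)) => //.
move=> _ [B + <-]; rewrite -bigcup_seq => -[i _ [A mA <-]].
rewrite !setTI -comp_preimage (_ : _ \o _ = @tnth d R ^~ i).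
  by rewrite -[X in measurable X]setTI; exact: measurable_tnth.
by apply/funext => t /=; rewrite /coords mxE.
Qed.

Local Open Scope ereal_scope.

Definition lebesgue_col : set 'cV[R]_d -> \bar R :=
  pushforward (@lebesgue_tuple R d) col_of_tuple.

Let lebesgue_col0 : lebesgue_col set0 = 0.
Proof. by rewrite /lebesgue_col /pushforward preimage_set0 measure0. Qed.

Let lebesgue_col_ge0 A : 0 <= lebesgue_col A.
Proof. exact: (measure_ge0 (lebesgue_tuple d)). Qed.

Let lebesgue_col_sigma_additive : semi_sigma_additive lebesgue_col.
Proof.
have mf := measurable_col_of_tuple.
move=> F mF tF mUF; rewrite /lebesgue_col /pushforward preimage_bigcup.
apply: (@measure_semi_sigma_additive _ _ _ (lebesgue_tuple d)).
- by move=> k; rewrite -[X in measurable X]setTI; exact: mf.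
- apply/trivIsetP => /= i j _ _ ij; rewrite -preimage_setI.
  by move/trivIsetP : tF => /(_ _ _ _ _ ij) ->//; rewrite preimage_set0.
- by rewrite -preimage_bigcup -[X in measurable X]setTI; exact: mf.
Qed.

HB.instance Definition _ := isMeasure.Build _ _ _ lebesgue_col
  lebesgue_col0 lebesgue_col_ge0 lebesgue_col_sigma_additive.

End MeasurableCol.

Section ComplexFunctions.
Context {disp : measure_display} {T : measurableType disp} {R : realType}.

Definition cmeasurable (D : set T) (f : T -> R[i]) :=
  measurable_fun D (fun x => complex.Re (f x)) /\ measurable_fun D (fun x => complex.Im (f x)).

Definition cintegral (mu : {measure set T -> \bar R}) (D : set T)
    (f : T -> R[i]) : R[i] :=
  (\int[mu]_(x in D) complex.Re (f x)) +i* (\int[mu]_(x in D) complex.Im (f x)).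

End ComplexFunctions.

Section Sobolev.
Context {R : realType} {d : nat}.
Implicit Types (u g : 'cV[R]_d -> R[i]) (phi : 'cV[R]_d -> R) (j : 'I_d).

Definition partial j phi : 'cV[R]_d -> R := 'D_(delta_mx j 0) phi.

Definition iter_partial (s : seq 'I_d) phi := foldr partial phi s.

Definition smooth phi := forall s : seq 'I_d,
  continuous (iter_partial s phi) /\
  forall j x, derivable (iter_partial s phi) x (delta_mx j 0).

Definition test_function phi :=
  smooth phi /\ compact (closure [set x | phi x != 0]).

Definition locally_summable u := cmeasurable setT u /\
  forall K, compact K ->
    (\int[@lebesgue_col R d]_(x in K) (normc (u x))%:E < +oo)%E.

Definition is_weak_partial j u g := [/\ locally_summable u, locally_summable g &
  forall phi, test_function phi ->
    cintegral (@lebesgue_col R d) setT (fun x => u x * (partial j phi x)%:C) =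
    - cintegral (@lebesgue_col R d) setT (fun x => g x * (phi x)%:C)].

Definition weakly_differentiable u := forall j, exists g, is_weak_partial j u g.

(* Unique up to a null set when it exists; only integrals of it are used. *)
Definition weak_partial j u : 'cV[R]_d -> R[i] :=
  xget (cst 0) [set g | is_weak_partial j u g].

End Sobolev.

Section Potentials.
Context {R : realType} {d : nat}.
Implicit Types (Omega : 'I_d./2 -> R) (gamma : 'I_d -> R) (x : 'cV[R]_d).

Lemma block_fst_subproof (k : 'I_d./2) : (k.*2 < d)%N.
Proof.
by have := ltn_ord k; rewrite -ltn_double => /leq_trans; apply;
  rewrite -[leqRHS](odd_double_half d) leq_addl.
Qed.

Lemma block_snd_subproof (k : 'I_d./2) : (k.*2.+1 < d)%N.
Proof.
by have := ltn_ord k; rewrite -leq_double doubleS => /leq_trans; apply;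
  rewrite -[leqRHS](odd_double_half d) leq_addl.
Qed.

(* The two coordinates of the k-th diagonal block (2k-1 and 2k when blocks and
   coordinates are numbered from 1). *)
Definition block_fst (k : 'I_d./2) : 'I_d := Ordinal (block_fst_subproof k).
Definition block_snd (k : 'I_d./2) : 'I_d := Ordinal (block_snd_subproof k).

(* The k-th diagonal block is Omega k times [[0, -1], [1, 0]]. *)
Definition rotation_mx Omega : 'M[R]_d :=
  \sum_k Omega k *: (delta_mx (block_snd k) (block_fst k)
                    - delta_mx (block_fst k) (block_snd k)).

Definition magnetic_potential Omega x : 'cV[R]_d := rotation_mx Omega *m x.

Definition sqnorm x : R := \sum_j x j 0 ^+ 2.

Definition V_gamma gamma x : R :=
  2^-1 * \sum_j Num.sg (gamma j) * gamma j ^+ 2 * x j 0 ^+ 2.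

Definition V_magnetic Omega gamma x : R :=
  V_gamma gamma x - sqnorm (magnetic_potential Omega x) / 2.

End Potentials.

Section Nonlinearity.
Context {R : realType} {d : nat}.
Variable N : 'cV[R]_d -> R[i] -> R[i].

(* z stands for |u|^2, hence the upper bound |u| = sqrt z. *)
Definition potential_C (x : 'cV[R]_d) (z : R) : R[i] :=
  2 * cintegral (@lebesgue_measure R) `[0, Num.sqrt z] (fun s => N x s%:C).

Definition potential (x : 'cV[R]_d) (z : R) : R := complex.Re (potential_C x z).

Definition potential_real := forall x z, 0 <= z -> complex.Im (potential_C x z) = 0.

Definition derives_from_potential :=
  forall x v, N x v = (derive1 (potential x) (normc v ^+ 2))%:C * v.

End Nonlinearity.

Section Energy.
Context {R : realType} {d : nat}.
Variables (Omega : 'I_d./2 -> R) (gamma : 'I_d -> R).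
Implicit Type u : 'cV[R]_d -> R[i].

Local Notation A := (magnetic_potential Omega).
Local Notation V := (V_magnetic Omega gamma).

Definition Sigma_norm u : \bar R :=
  ((\int[@lebesgue_col R d]_x
      (\sum_j normc (weak_partial j u x) ^+ 2 +
       (1 + sqnorm (A x) + `|V x|) * normc (u x) ^+ 2)%:E) `^ 2^-1)%E.

Definition Sigma u :=
  [/\ cmeasurable setT u, weakly_differentiable u & (Sigma_norm u < +oo)%E].

Definition S1 u := Sigma u /\
  (\int[@lebesgue_col R d]_x (normc (u x) ^+ 2)%:E = 1)%E.

Definition magnetic_partial j u x : R[i] :=
  weak_partial j u x - 'i * (A x j 0)%:C * u x.

Variable N : 'cV[R]_d -> R[i] -> R[i].

(* The integrand is integrable on Sigma when N has at most subcritical growth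
   (Sobolev embedding), so the energy is a real number there. *)
Definition energy u : R :=
  \int[@lebesgue_col R d]_x
    (2^-1 * \sum_j normc (magnetic_partial j u x) ^+ 2
     + V x * normc (u x) ^+ 2 + potential N x (normc (u x) ^+ 2)).

Definition I1 : \bar R := ereal_inf [set (energy u)%:E | u in S1].

Definition ground_state u := S1 u /\ (energy u)%:E = I1.

End Energy.

(* Main.v *)
(* The energies of normalised states are unbounded below, so no state attains the
   infimum.  Fix a smooth bump phi supported in the unit ball with unit mass and put
   u_a(x) = exp(i A(a).x) phi(x - a).  Since A is linear, the phase turns
   (grad - iA(x)) u_a into (grad - iA(x - a)) phi(x - a) up to a unimodular factor, so
   the magnetic kinetic energy does not depend on a; the nonlinear term is bounded
   because |phi| is.  The remaining term is an average of V over the unit ball around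
   a, and instability gives a coordinate direction e_i with V(e_i) < 0; V being a
   quadratic form, the energy of u_a tends to -oo for a = r e_i, r -> +oo.

   Weak partials are only chosen up to null sets, so the energy of u_a is computed
   from their a.e. uniqueness: the test functions
   prod_j psi(n (x_j - a_j)) psi(n (b_j - x_j)), psi(t) = exp(-1/t), increase to the
   indicator of an open box, and boxes generate the Borel sets.  That classical
   partials are weak ones follows from translation invariance of the measure applied
   to difference quotients. *)
Require Import Defs.
From HB Require Import structures.
From mathcomp Require Import all_boot all_order all_algebra.
From mathcomp Require Import complex.
From mathcomp Require Import all_classical all_reals all_analysis.
From mathcomp Require Import measurable_realfun ring lra.
Import Order.TTheory GRing.Theory Num.Theory.
Import numFieldNormedType.Exports Normc.
Local Open Scope classical_set_scope.
Local Open Scope ring_scope.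
Local Open Scope complex_scope.
Set Implicit Arguments.
Unset Strict Implicit.
Unset Printing Implicit Defensive.

(** * Balls, boxes and Borel sets in the space of columns, and their Lebesgue measure *)

Lemma closed_norm_le {R : realType} (V : normedModType R) (r : R) :
  closed [set x : V | `|x| <= r].
Proof.
apply: (@closed_comp _ _ (fun x : V => `|x|) [set t | t <= r]).
  by move=> x _; exact: norm_continuous.
exact: closed_le.
Qed.

Section Columns.
Context {R : realType} {d : nat}.
Local Notation cV := 'cV[R]_d.
Implicit Types (x y : cV) (a b : 'I_d -> R).

Lemma col_norm_le x r : 0 <= r ->
  (forall i, `|x i 0| <= r) <-> `|x| <= r.
Proof.
move=> r0; have -> : `|x| = \big[Num.max/0]_ij `|x ij.1 ij.2|.
  exact: mx_normrE.
split=> [h|/bigmax_leP[_ h] i]; last exact: (h (i, 0)).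
by apply/bigmax_leP; split=> // -[i j] _ /=; rewrite (ord1 j).
Qed.

Lemma coord_le_norm x i : `|x i 0| <= `|x|.
Proof. by have [_] := col_norm_le x (normr_ge0 x); apply. Qed.

Lemma measurable_coord i : measurable_fun setT (fun x : cV => x i 0).
Proof.
move=> _ A mA; rewrite setTI; apply: sub_sigma_algebra.
rewrite -bigcup_seq; exists i; first exact: mem_index_enum.
by exists A => //; rewrite setTI.
Qed.

Lemma measurable_to_col disp (T : measurableType disp) (f : T -> cV) :
  (forall i, measurable_fun setT (fun t => f t i 0)) -> measurable_fun setT f.
Proof.
move=> mf; apply: (measurability (\big[setU/set0]_(i < d)
  preimage_set_system setT (fun x : cV => x i 0) measurable)) => //.
move=> _ [B + <-]; rewrite -bigcup_seq => -[i _ [A mA <-]].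
rewrite !setTI -comp_preimage -[X in measurable X]setTI.
exact: mf.
Qed.

Lemma coord_cts i : continuous (fun x : cV => x i 0).
Proof. exact: coord_continuous. Qed.

Definition obox a b : set cV := [set x | forall i, x i 0 \in `]a i, b i[].

Lemma measurable_box (A : 'I_d -> set R) : (forall i, measurable (A i)) ->
  measurable [set x : cV | forall i, A i (x i 0)].
Proof.
move=> mA; have -> : [set x : cV | forall i, A i (x i 0)] =
    \bigcap_(i in setT) ((fun x : cV => x i 0) @^-1` A i).
  by apply/seteqP; split=> t /= At i => [_|]; exact: At.
apply: fin_bigcap_measurable; first exact: finite_finset.
move=> i _; rewrite -[X in measurable X]setTI.
by apply: measurable_coord => //; exact: mA.
Qed.

Lemma measurable_obox a b : measurable (obox a b).
Proof.
by apply: (@measurable_box (fun i => `]a i, b i[%classic)) => i; exact: measurable_itv.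
Qed.

(** The sigma-algebra on columns is generated by the coordinates, so Borel sets have to be
    recovered: an open set is the countable union of the boxes with rational centre and rational
    half-width that it contains. *)
Lemma open_measurable_col (U : set cV) : open U -> measurable U.
Proof.
move=> oU.
pose B (q : 'cV[rat]_d * rat) : set cV :=
  obox (fun i => ratr (q.1 i 0) - ratr q.2) (fun i => ratr (q.1 i 0) + ratr q.2).
have -> : U = \bigcup_(q in [set q | B q `<=` U]) B q.
  apply/seteqP; split=> [x Ux|x [q /=]]; last exact.
  have /nbhs_ballP[e /= e0 eU] : nbhs x U by exact: open_nbhs_nbhs.
  (* With half-width [r] below [e / 2], a box whose centre is within [r] of [x] contains [x] and
     lies in the [e]-ball of [x]. *)
  have [r /[!in_itv]/= /andP[r0 re]] := @rat_in_itvoo R 0 (e / 2) (divr_gt0 e0 (ltr0Sn R 1)).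
  have /choice[q qx] : forall i, exists s : rat, ratr s \in `](x i 0 - ratr r), (x i 0 : R)[.
    by move=> i; apply: rat_in_itvoo; rewrite ltrBlDr ltrDl.
  exists (\col_i q i, r) => /=; last first.
    move=> i; have := qx i; rewrite !in_itv/= mxE => /andP[]; lra.
  move=> y By; apply: eU; split=> // i j; rewrite (ord1 j) /ball/=.
  have := By i; have := qx i; rewrite !in_itv/= mxE ltr_norml => /andP[h1 h2] /andP[h3 h4].
  by apply/andP; split; lra.
rewrite bigcup_mkcond; apply: countable_bigcupT_measurable => [|q].
  exact: countableP.
by case: ifPn => _ //; exact: measurable_obox.
Qed.

Lemma closed_measurable_col (U : set cV) : closed U -> measurable U.
Proof.
move=> /closed_openC/open_measurable_col/measurableC; rewrite setCK; exact.
Qed.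

Lemma continuous_measurable_col (f : cV -> R) :
  continuous f -> measurable_fun setT f.
Proof.
move=> /continuousP cf; apply: (measurability _ (RGenOpens.measurableE R)) => //.
move=> _ [_ [a [b ->]] <-]; rewrite setTI; apply: open_measurable_col.
by apply: cf; exact: itv_open.
Qed.

(** Heine-Borel for row vectors is carried over by transposition, an isometry for the maximum
    norm. *)
Lemma compact_norm_le r : compact [set x : cV | `|x| <= r].
Proof.
pose K := [set v : 'rV[R]_d | `|v| <= r].
have trn (v : 'rV[R]_d) : `|v^T| = `|v|.
  have h m n (w : 'M[R]_(m, n)) : `|w| = \big[Num.max/0]_ij `|w ij.1 ij.2|.
    exact: mx_normrE.
  rewrite !h; apply/le_anti/andP; split.
    by apply/bigmax_leP; split=> [|[i j] _]; [exact: bigmax_ge_id|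
      rewrite /= mxE; exact: (le_bigmax _ (fun i => `|v i.1 i.2|) (j, i))].
  apply/bigmax_leP; split=> [|[i j] _]; first exact: bigmax_ge_id.
  by apply: le_trans (le_bigmax _ _ (j, i)) => /=; rewrite mxE.
have -> : [set x : cV | `|x| <= r] = trmx @` K.
  apply/seteqP; split=> [x /= xr|_ [v Kv <-]]; last by rewrite /= trn.
  by exists x^T; rewrite ?trmxK// /K/= -trn trmxK.
apply: continuous_compact.
  apply: continuous_subspaceT => v U /nbhs_ballP[e e0 eU].
  apply/nbhs_ballP; exists e => // w [_ vw]; apply: eU; split=> // i j.
  by rewrite !mxE; exact: vw.
apply: bounded_closed_compact.
  exists r; split; first exact: num_real.
  by move=> s rs v /= vr; rewrite (le_trans vr)// ltW.
exact: closed_norm_le.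
Qed.

Lemma continuous_bounded_norm_le (f : cV -> R) r : continuous f ->
  exists2 M : R, 0 < M & forall x, `|x| <= r -> `|f x| <= M.
Proof.
move=> cf; have /compact_bounded/ex_strict_bound_gt0[M M0 fM] :
    compact (f @` [set x | `|x| <= r]).
  by apply: continuous_compact; [exact: continuous_subspaceT|exact: compact_norm_le].
by exists M => // x xr; apply/ltW/fM; exists x.
Qed.

Lemma measurable_norm_le r : measurable [set x : cV | `|x| <= r].
Proof.
apply: closed_measurable_col; exact: closed_norm_le.
Qed.

Lemma compact_sub_norm_le (K : set cV) : compact K ->
  exists2 r, 0 < r & K `<=` [set x | `|x| <= r].
Proof.
move=> /compact_bounded/ex_strict_bound_gt0[M /= M0 KM].
by exists M => // x /KM /ltW.
Qed.

(** The preimage of an open interval under one coordinate is the increasing union of boxes with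
    sides []-n, n[] in the other coordinates. Generation by boxes feeds the uniqueness theorem for
    measures and the Dynkin argument below. *)
Lemma obox_gen : @measurable _ cV = <<s [set obox a b | a in setT & b in setT] >>.
Proof.
apply/seteqP; split; last first.
  apply: smallest_sub; first exact: sigma_algebra_measurable.
  by move=> _ [a _ [b _ <-]]; exact: measurable_obox.
set S := <<s _ >>.
have sS : sigma_algebra setT S by exact: smallest_sigma_algebra.
apply: smallest_sub => // A.
rewrite -bigcup_seq => -[i _ [B mB <-]]; rewrite setTI.
suff : <<s @RGenOpens.G R >> `<=`
    [set C : set R | S ((fun x : cV => x i 0) @^-1` C)].
  apply; have := congr1 (@^~ B) (RGenOpens.measurableE R).
  by move=> /= h; have : (RGenOpens.G (R:=R)).-sigma.-measurable B by rewrite -h.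
apply: smallest_sub.
  split=> [|C /= SC|F /= SF].
  - by rewrite /= preimage_set0; case: sS.
  - by rewrite setTD preimage_setC; case: sS => _ h _; rewrite -setTD; exact: h.
  - by rewrite preimage_bigcup; case: sS => _ _; exact.
move=> _ [p [q ->]] /=.
have -> : (fun x : cV => x i 0) @^-1` `]p, q[ =
  \bigcup_n obox (fun j => if j == i then p else - n%:R)
                 (fun j => if j == i then q else n%:R).
  apply/seteqP; split=> [x /= xpq|x [n _ /(_ i)]]; last by rewrite eqxx.
  have [n xn] : exists n, `|x| < n%:R.
    by exists (Num.truncn `|x|).+1; exact: truncnS_gt.
  exists n => // j; case: eqVneq => [->//|_].
  by rewrite in_itv/= -ltr_norml; exact: le_lt_trans (coord_le_norm _ _) xn.
case: sS => _ _; apply=> n; apply: sub_sigma_algebra.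
by eexists => //; eexists.
Qed.

Lemma obox_setI a b a' b' : obox a b `&` obox a' b' =
  obox (fun i => Num.max (a i) (a' i)) (fun i => Num.min (b i) (b' i)).
Proof.
apply/seteqP; split=> [x [h h'] i|x h]; last split=> i.
- have := h i; have := h' i; rewrite !in_itv/= gt_max lt_min.
  by move=> /andP[-> ->] /andP[-> ->].
- by have := h i; rewrite !in_itv/= gt_max lt_min => /andP[/andP[-> _] /andP[-> _]].
- by have := h i; rewrite !in_itv/= gt_max lt_min => /andP[/andP[_ ->] /andP[_ ->]].
Qed.

Lemma obox_setI_closed : setI_closed [set obox a b | a in setT & b in setT].
Proof.
move=> _ _ [a _ [b _ <-]] [a' _ [b' _ <-]]; rewrite obox_setI.
by eexists => //; eexists.
Qed.

Local Notation mu := (@lebesgue_col R d).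

Lemma lebesgue_obox a b :
  mu (obox a b) = (\prod_(i < d) lebesgue_measure `]a i, b i[%classic)%E.
Proof.
rewrite /lebesgue_col /pushforward.
rewrite -(@lebesgue_tuple_box R d (fun i => `]a i, b i[%classic)); last first.
  by move=> i; exact: measurable_itv.
congr (lebesgue_tuple d _); apply/seteqP.
by split=> t /= h i; have := h i; rewrite /col_of_tuple mxE.
Qed.

Lemma lebesgue_obox_lty a b : (mu (obox a b) < +oo)%E.
Proof.
rewrite lebesgue_obox ltey_eq; apply/orP; left; apply: prode_fin_num => i _.
by rewrite lebesgue_measure_itv; case: ifP.
Qed.

Lemma lebesgue_obox_gt0 a b : (forall i, a i < b i) -> (0 < mu (obox a b))%E.
Proof.
move=> ab; rewrite lebesgue_obox; elim/big_ind: _ => //.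
  by move=> x y; exact: mule_gt0.
by move=> i _; rewrite lebesgue_measure_itv/= lte_fin ab -EFinD lte_fin subr_gt0.
Qed.

Lemma norm_le_sub_obox r : [set x : cV | `|x| <= r] `<=`
  obox (fun=> - (r + 1)) (fun=> r + 1).
Proof.
move=> x /= xr i; rewrite in_itv/= -ltr_norml.
by rewrite (le_lt_trans (coord_le_norm _ _))// (le_lt_trans xr)// ltrDl.
Qed.

Lemma lebesgue_norm_le_lty r : (mu [set x : cV | (`|x| <= r)%R] < +oo)%E.
Proof.
apply: le_lt_trans (lebesgue_obox_lty (fun=> - (r + 1)) (fun=> r + 1)).
apply: le_measure; rewrite ?inE; [exact: measurable_norm_le|exact: measurable_obox|].
exact: norm_le_sub_obox.
Qed.

Lemma measurable_shift_col (c : cV) : measurable_fun setT (fun x : cV => x + c).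
Proof.
apply: measurable_to_col => i.
under eq_fun do rewrite mxE.
by apply: measurable_funD => //; exact: measurable_coord.
Qed.

End Columns.

(** * Monotonicity of the integral for arbitrary integrands *)

Section NonMeasurableMonotonicity.
Context d (T : measurableType d) (R : realType).
Variable mu : {measure set T -> \bar R}.
Local Open Scope ereal_scope.
Import HBNNSimple.

(* The integral of a nonnegative function is a supremum over the simple functions
   below it, hence monotone also on non-measurable integrands; this spares proving
   that [x |-> G(x, |u(x)|^2)] is measurable. *)
Lemma ge0_ae_le_integral_sup (f g : T -> \bar R) :
  (forall x, 0 <= f x) -> (forall x, 0 <= g x) ->
  {ae mu, forall x, f x <= g x} -> \int[mu]_x f x <= \int[mu]_x g x.
Proof.
move=> f0 g0 [E [mE E0 fgE]]; rewrite !ge0_integralTE//.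
apply: ge_ereal_sup => _ [h /= hf <-].
have mEC : measurable (~` E) by exact: measurableC.
(* Cutting [h] off on the null set [E] keeps its integral and puts it below [g] everywhere. *)
pose h' : {nnsfun T >-> R} := proj_nnsfun h mEC.
have -> : sintegral mu h = sintegral mu h'.
  rewrite -!integralT_nnsfun; apply: ge0_ae_eq_integral => //.
  - by apply/measurable_EFinP; exact: measurable_funP.
  - by apply/measurable_EFinP; exact: measurable_funP.
  - by move=> x _; rewrite lee_fin.
  - by move=> x _; rewrite lee_fin.
  exists E; split=> // x /=; apply: contra_notP => Ex _.
  by rewrite /h'/= mindicE mem_set// mulr1.
apply: ereal_sup_ubound; exists h' => // x; rewrite /h'/= mindicE.
have [Ex|Ex] := boolP (x \in ~` E); last by rewrite mulr0.
rewrite mulr1; apply: le_trans (hf x) _; apply: contrapT => fg.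
by move: Ex; rewrite inE; apply; exact: fgE.
Qed.

(** From [F] to [H] the integral of the positive part increases and that of the negative part
    decreases. The common integrable bound [K] keeps all four integrals finite, so that [fine]
    respects the comparison of the differences. *)
Lemma le_Rintegral_sup (F H K : T -> R) : mu.-integrable setT (EFin \o K) ->
  {ae mu, forall x, `|F x| <= K x}%R -> {ae mu, forall x, `|H x| <= K x}%R ->
  {ae mu, forall x, F x <= H x}%R ->
  (Rintegral mu setT F <= Rintegral mu setT H)%R.
Proof.
move=> iK FK HK FH.
have iKp := integral_funepos_lt_pinfty measurableT iK.
have parts_fin (f : T -> R) : {ae mu, forall x, `|f x| <= K x}%R ->
    \int[mu]_x (EFin \o f)^\+ x \is a fin_num /\
    \int[mu]_x (EFin \o f)^\- x \is a fin_num.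
  move=> fK; rewrite !ge0_fin_numE ?integral_ge0//.
  split; apply: le_lt_trans iKp; apply: ge0_ae_le_integral_sup => //;
    apply: filterS fK => x; rewrite ler_norml => /andP[h1 h2].
    by rewrite !funeposE ge_max !le_max/= !lee_fin h2 lexx orbT.
  by rewrite funenegE funeposE ge_max !le_max/= !lee_fin lerNl h1 lexx orbT.
have [Fp Fn] := parts_fin _ FK; have [Hp Hn] := parts_fin _ HK.
have FpHp : \int[mu]_x (EFin \o F)^\+ x <= \int[mu]_x (EFin \o H)^\+ x.
  apply: ge0_ae_le_integral_sup => //; apply: filterS FH => x h.
  by rewrite !funeposE ge_max !le_max/= lee_fin h lexx orbT.
have HnFn : \int[mu]_x (EFin \o H)^\- x <= \int[mu]_x (EFin \o F)^\- x.
  apply: ge0_ae_le_integral_sup => //; apply: filterS FH => x h.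
  by rewrite !funenegE ge_max !le_max/= lee_fin lerN2 h lexx orbT.
have le_fineB (a b a' b' : \bar R) : a \is a fin_num -> b \is a fin_num ->
    a' \is a fin_num -> b' \is a fin_num -> a <= a' -> b' <= b ->
    (fine (a - b) <= fine (a' - b'))%R.
  move=> fa fb fa' fb' aa' bb'.
  by rewrite fine_le ?fin_numB ?fa ?fb ?fa' ?fb'//; exact: leeB.
by rewrite /Rintegral integralE [X in (_ <= fine X)%R]integralE; exact: le_fineB.
Qed.

End NonMeasurableMonotonicity.

(** * Translation invariance of Lebesgue measure on columns *)

Section Shift.
Context {R : realType} {d : nat}.
Local Notation cV := 'cV[R]_d.
Local Notation mu := (@lebesgue_col R d).
Implicit Types (c : cV).

(** The shifted measure and [mu] agree on boxes, a generating family closed under intersection, and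
    the boxes with sides []-n, n[] have finite measure and exhaust the space; uniqueness of measures
    applies. *)
Lemma lebesgue_shift c (A : set cV) : measurable A ->
  mu ((fun x => x + c) @^-1` A) = mu A.
Proof.
move=> mA.
(* The measure structure of the pushforward is named in full in order to pass it the measurability
   of the shift. *)
pose m1 := measure_function_pushforward__canonical__measure_function_Measure
  mu (measurable_shift_col c).
apply: (measure_unique _
  (fun n : nat => obox (fun=> - n%:R) (fun=> n%:R)) obox_gen obox_setI_closed _ _
  m1 mu) => //.
- by move=> n; eexists => //; eexists.
- rewrite -subTset => x _.
  have [n xn] : exists n, `|x| < n%:R.
    by exists (Num.truncn `|x|).+1; exact: truncnS_gt.
  exists n => // j; rewrite in_itv/= -ltr_norml.
  exact: le_lt_trans (coord_le_norm _ _) xn.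
- move=> _ [a _ [b _ <-]].
  rewrite /m1/= /pushforward (_ : _ @^-1` _ =
    obox (fun i => a i - c i 0) (fun i => b i - c i 0)).
    rewrite !lebesgue_obox; apply: eq_bigr => i _.
    rewrite !lebesgue_measure_itv/= !lte_fin ltrD2r; case: ifP => // _.
    by congr EFin; ring.
  apply/seteqP; split=> x /= h i; have := h i; rewrite !in_itv/= mxE.
    by rewrite ltrBlDr ltrBrDr.
  by rewrite ltrBlDr ltrBrDr.
- move=> n; rewrite /m1/= /pushforward (_ : _ @^-1` _ =
    obox (fun i => - n%:R - c i 0) (fun i => n%:R - c i 0)).
    exact: lebesgue_obox_lty.
  apply/seteqP; split=> x /= h i; have := h i; rewrite !in_itv/= mxE.
    by rewrite ltrBlDr ltrBrDr.
  by rewrite ltrBlDr ltrBrDr.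
Qed.

Lemma ge0_integral_shift c (f : cV -> \bar R) : measurable_fun setT f ->
  (forall x, 0 <= f x)%E -> (\int[mu]_x f (x + c)%R = \int[mu]_x f x)%E.
Proof.
move=> mf f0.
rewrite -[LHS](@ge0_integral_pushforward _ _ _ _ _ _ (measurable_shift_col c) mu setT f)//.
pose m1 := measure_function_pushforward__canonical__measure_function_Measure
  mu (measurable_shift_col c).
apply: (@eq_measure_integral _ _ _ _ mu m1) => A mA _.
exact: lebesgue_shift.
Qed.

Lemma measurable_comp_shift c (f : cV -> R) : measurable_fun setT f ->
  measurable_fun setT (fun x : cV => f (x + c)).
Proof. by move=> mf; apply: measurableT_comp => //; exact: measurable_shift_col. Qed.

Lemma integrable_shift c (f : cV -> R) : mu.-integrable setT (EFin \o f) ->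
  mu.-integrable setT (EFin \o (fun x : cV => f (x + c))).
Proof.
move=> /integrableP[/measurable_EFinP mf foo]; apply/integrableP; split.
  by apply/measurable_EFinP; exact: measurable_comp_shift.
rewrite (ge0_integral_shift c (f := fun x => `|(f x)%:E|)%E)//.
by apply/measurableT_comp => //; exact/measurable_EFinP.
Qed.

Lemma integral_shift c (f : cV -> R) : mu.-integrable setT (EFin \o f) ->
  Rintegral mu setT (fun x : cV => f (x + c)) = Rintegral mu setT f.
Proof.
move=> if_; have /integrableP[/measurable_EFinP mf _] := if_.
have mEf : measurable_fun setT (EFin \o f) by exact/measurable_EFinP.
have hp := ge0_integral_shift c (measurable_funepos mEf) (@funepos_ge0 _ _ _).
have hn := ge0_integral_shift c (measurable_funeneg mEf) (@funeneg_ge0 _ _ _).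
rewrite /Rintegral integralE [in RHS]integralE.
congr (fine (_ - _)); [rewrite -hp|rewrite -hn]; apply: eq_integral => x _.
  by rewrite !funeposE.
by rewrite !funenegE.
Qed.

End Shift.

(** * Directional derivatives as derivatives along a line *)

Section Slice.
Variables (R : realType) (V : normedModType R).
Implicit Types (f : V -> R) (x v : V) (t : R).

(** The two difference quotients are the same function of the increment. The chain rule and the mean
    value theorem in one real variable thereby become available for directional derivatives. *)
Lemma is_derive_slice f x v t df :
  is_derive (t *: v + x) v f df <-> is_derive t 1 (fun s : R => f (s *: v + x)) df.
Proof.
have E : (fun h : R => h^-1 *: (((fun s : R => f (s *: v + x)) \o shift t) (h *: 1)
      - f (t *: v + x))) =
    (fun h : R => h^-1 *: ((f \o shift (t *: v + x)) (h *: v) - f (t *: v + x))).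
  by apply/funext => h /=; rewrite [h *: 1]mulr1 scalerDl addrA.
split=> -[h1 h2]; apply: DeriveDef.
- by rewrite /derivable E.
- by rewrite /derive E.
- by rewrite /derivable -E.
- by rewrite /derive -E.
Qed.

Lemma is_derive_slice0 f x v df :
  is_derive x v f df <-> is_derive (0 : R) (1 : R) (fun s : R => f (s *: v + x)) df.
Proof. by rewrite -is_derive_slice scale0r add0r. Qed.

(** Mean value theorem on the segment from [x] to [h *: v + x]; it will dominate difference
    quotients uniformly in the step. *)
Lemma slice_lipschitz f (g : V -> R) x v M h : 0 <= h ->
  (forall y, is_derive y v f (g y)) -> (forall y, `|g y| <= M) ->
  `|f (h *: v + x) - f x| <= M * h.
Proof.
move=> h0 fg gM.
have dF t : is_derive t 1 (fun s : R => f (s *: v + x)) (g (t *: v + x)).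
  exact/is_derive_slice.
have cF : {within `[0, h], continuous (fun s : R => f (s *: v + x))}.
  apply: continuous_subspaceT => t.
  by apply/differentiable_continuous/derivable1_diffP; have [] := dF t.
have [c _] := MVT_segment h0 (fun t _ => dF t) cF.
rewrite scale0r add0r subr0 => ->; rewrite normrM (ger0_norm h0).
exact: ler_wpM2r.
Qed.

(** The increments [1 / (n + 1)] give a limit along a sequence, as dominated convergence
    requires. *)
Lemma is_derive_cvg_quotient f x v df : is_derive x v f df ->
  (fun n : nat => n.+1%:R * (f (n.+1%:R^-1 *: v + x) - f x)) @ \oo --> df.
Proof.
move=> [/[swap] <- dfx].
have /cvgr_dnbhsP h : (fun h : R => h^-1 *: ((f \o shift x) (h *: v) - f x)) @ 0^' -->
  'D_v f x by exact: dfx.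
have : (fun n : nat => n.+1%:R^-1^-1 * (f (n.+1%:R^-1 *: v + x) - f x)) @ \oo -->
    'D_v f x.
  apply: (h (fun n => n.+1%:R^-1)); split=> [n|]; last exact: cvg_harmonic.
  by rewrite invr_eq0 pnatr_eq0.
by under eq_fun do rewrite invrK.
Qed.

End Slice.

(** * Integration by parts against test functions *)

Section IntegrationByParts.
Context {R : realType} {d : nat}.
Local Notation cV := 'cV[R]_d.
Local Notation mu := (@lebesgue_col R d).
Local Notation e j := (delta_mx j 0 : cV).
Implicit Types (f g v w phi : cV -> R) (j : 'I_d).

Definition supported (r : R) f := forall x, r < `|x| -> f x = 0.

Lemma norm_delta_le1 j : `|e j| <= 1.
Proof.
apply/col_norm_le => // i; rewrite mxE eqxx andbT.
by case: (_ == _); rewrite ?normr0 ?normr1.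
Qed.

Lemma integrable_bounded_supported f M r : measurable_fun setT f ->
  (forall x, `|f x| <= M) -> supported r f -> mu.-integrable setT (EFin \o f).
Proof.
move=> mf fM fr; pose B := [set x : cV | `|x| <= r].
have mB : measurable B by exact: measurable_norm_le.
have -> : EFin \o f = (EFin \o f) \_ B.
  apply/funext => x; rewrite patchE; case: ifPn => //=.
  by rewrite notin_setE => /negP; rewrite -ltNge => /fr ->.
apply/(integrable_mkcond _ mB).1; apply: measurable_bounded_integrable => //.
- exact: lebesgue_norm_le_lty.
- exact: measurable_funTS.
- exists M; split; first exact: num_real.
  by move=> s Ms x _ /=; rewrite (le_trans (fM x))// ltW.
Qed.

Lemma integrable_cst_norm_le (M r : R) :
  mu.-integrable setT (fun x => (M * \1_[set y : cV | `|y| <= r] x)%:E).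
Proof.
apply: (integrable_bounded_supported (M := `|M|) (r := r)).
- apply: measurable_funM => //; apply: measurable_indic; exact: measurable_norm_le.
- move=> x; rewrite indicE normrM ler_piMr//.
  by rewrite normr_nat; case: (_ \in _).
- move=> x rx; rewrite indicE memNset ?mulr0//= => /(lt_le_trans rx).
  by rewrite ltxx.
Qed.

Lemma continuous_supported_bounded f r : continuous f -> supported r f ->
  exists2 M : R, 0 < M & forall x, `|f x| <= M.
Proof.
move=> cf fr; have [M M0 fM] := continuous_bounded_norm_le r cf.
exists M => // x; have [xr|rx] := leP `|x| r; first exact: fM.
by rewrite fr// normr0 ltW.
Qed.

Lemma integrable_continuous_supported f r : continuous f -> supported r f ->
  mu.-integrable setT (EFin \o f).
Proof.
move=> cf fr; have [M _ fM] := continuous_supported_bounded cf fr.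
by apply: (integrable_bounded_supported (M := M) (r := r)) => //;
  exact: continuous_measurable_col.
Qed.

Lemma supported_is_derive j f g r : supported r f ->
  (forall x, is_derive x (e j) f (g x)) -> supported r g.
Proof.
move=> fr fg x rx; have [_ <-] := fg x.
rewrite (near_eq_derive _ (g := cst 0)) ?derive_cst//.
have : open [set y : cV | r < `|y|].
  have -> : [set y : cV | r < `|y|] = ~` [set y : cV | `|y| <= r].
    by apply/seteqP; split=> y /=; rewrite ltNge => /negP.
  exact/closed_openC/closed_norm_le.
rewrite openE => /(_ x rx); apply: filterS => y /= ry.
exact: fr.
Qed.

(** By translation invariance every difference quotient of [f] has integral zero. The quotients
    converge to [g] and are bounded by [M] on a fixed ball, so dominated convergence passes to the
    limit. *)
Lemma Rintegral_partial_eq0 j f g r : continuous f -> continuous g ->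
  (forall x, is_derive x (e j) f (g x)) -> supported r f ->
  Rintegral mu setT g = 0.
Proof.
move=> cf cg fg fr.
have gr := supported_is_derive fr fg.
have [M M0 gM] := continuous_supported_bounded cg gr.
pose h n : R := n.+1%:R^-1.
have h0 n : 0 < h n by rewrite invr_gt0.
pose F n x := n.+1%:R * (f (x + h n *: e j) - f x).
have intf := integrable_continuous_supported cf fr.
have intfs n := integrable_shift (h n *: e j) intf.
have mf := continuous_measurable_col cf.
have mF n : measurable_fun setT (F n).
  apply: measurable_funM => //; apply: measurable_funB => //.
  exact: measurable_comp_shift.
have F0 (n : nat) : (\int[mu]_x (F n x)%:E = 0)%E.
  have -> : (fun x => (F n x)%:E) =
      (fun x => (n.+1%:R)%:E * ((f (x + h n *: e j))%:E - (f x)%:E))%E.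
    by apply/funext => x; rewrite -EFinB -EFinM.
  rewrite integralZl//; last exact: (integrableB measurableT (intfs n) intf).
  rewrite integralB//; last exact: (intfs n).
  have fin1 := integrable_fin_num measurableT intf.
  have fin2 := integrable_fin_num measurableT (intfs n).
  have := congr1 EFin (integral_shift (h n *: e j) intf).
  by rewrite /Rintegral (fineK fin1) (fineK fin2) => ->; rewrite subee ?mule0.
(* The radius grows by 1 because the step [h m *: e j] has norm at most 1: outside the larger ball
   both values of [f] vanish. *)
have FM m x : `|F m x| <= M * \1_[set y | `|y| <= r + 1] x.
  have [xr|xr] := leP `|x| (r + 1); last first.
    rewrite /F !fr ?subr0 ?mulr0 ?normr0 ?mulr_ge0// ?ltW//.
      by rewrite (le_lt_trans _ xr)// lerDl.
    rewrite -(ltrD2r 1); apply: lt_le_trans xr _.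
    rewrite -lerBlDr; apply: le_trans _ (lerB_normD _ _).
    rewrite lerB// normrZ (ger0_norm (ltW (h0 m))).
    by rewrite mulr_ile1 ?norm_delta_le1 ?(ltW (h0 m))// /h invf_le1// ler1n.
  rewrite indicE mem_set// mulr1 normrM normr_nat mulrC -ler_pdivlMr//.
  rewrite [x + _]addrC; apply: (slice_lipschitz (g := g)) => //; exact: ltW.
have mB : measurable [set y : cV | `|y| <= r + 1] by exact: measurable_norm_le.
have mFE n : measurable_fun setT (fun x => (F n x)%:E) by exact/measurable_EFinP.
have mgE : measurable_fun setT (EFin \o g).
  by apply/measurable_EFinP; exact: continuous_measurable_col.
have Fg : {ae mu, forall x, setT x -> (fun n => (F n x)%:E) @ \oo --> (EFin \o g) x}.
  apply: aeW => x _; apply: cvg_EFin; first by apply: nearW.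
  rewrite (_ : _ \o _ = F ^~ x); last by apply/funext => n.
  rewrite (_ : F ^~ x = fun n : nat => n.+1%:R * (f (n.+1%:R^-1 *: e j + x) - f x)).
    exact: (is_derive_cvg_quotient (fg x)).
  by apply/funext => n; rewrite /F [x + _]addrC.
have ig : mu.-integrable setT (fun x => (M * \1_[set y : cV | `|y| <= r + 1] x)%:E).
  exact: integrable_cst_norm_le.
have FME : {ae mu, forall x n, setT x ->
    (`|(F n x)%:E| <= (M * \1_[set y : cV | (`|y| <= r + 1)%R] x)%:E)%E}.
  by apply: aeW => x n _; rewrite lee_fin; exact: FM.
have [_ _] := dominated_convergence measurableT mFE mgE Fg ig FME.
have -> : [sequence (\int[mu]_x (F n x)%:E)%E]_n = cst 0%E.
  by apply/funext => n; exact: F0.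
move=> h1; rewrite /Rintegral.
suff <- : 0%E = (\int[mu]_x (EFin \o g) x)%E by [].
by apply: cvg_unique h1 => //; exact: cvg_cst.
Qed.

Lemma test_function_supported phi : test_function phi ->
  exists2 r : R, 0 < r & supported r phi.
Proof.
move=> [_ /compact_sub_norm_le[r r0 Kr]]; exists r => // x rx.
apply: contrapT => /eqP phix.
have /= : [set y : cV | `|y| <= r] x by apply/Kr/subset_closure.
by rewrite leNgt rx.
Qed.

Lemma smooth_continuous phi : smooth phi -> continuous phi.
Proof. by move=> /(_ [::])[]. Qed.

Lemma smooth_partial_continuous j phi : smooth phi -> continuous (partial j phi).
Proof. by move=> /(_ [:: j])[]. Qed.

Lemma smooth_is_derive j phi x : smooth phi -> is_derive x (e j) phi (partial j phi x).
Proof. by move=> /(_ [::])[_ h]; apply: derivableP; exact: h. Qed.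

(** By the product rule [v * partial j phi + w * phi] is the partial derivative of [v * phi], which
    has bounded support; its integral is zero. *)
Lemma integral_mul_partial j v w phi : continuous v -> continuous w ->
  (forall x, is_derive x (e j) v (w x)) -> test_function phi ->
  Rintegral mu setT (fun x => v x * partial j phi x) =
  - Rintegral mu setT (fun x => w x * phi x).
Proof.
move=> cv cw vw tphi; have [r r0 phir] := test_function_supported tphi.
have sphi := tphi.1.
have cphi := smooth_continuous sphi.
have cdphi := smooth_partial_continuous (j := j) sphi.
have dphi x : is_derive x (e j) phi (partial j phi x) by exact: smooth_is_derive.
have dphir := supported_is_derive phir dphi.
have cM (f g : cV -> R) : continuous f -> continuous g -> continuous (fun x => f x * g x).
  by move=> cf cg x; exact: (continuousM (cf x) (cg x)).
have i1 : mu.-integrable setT (EFin \o (fun x => v x * partial j phi x)).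
  apply: (integrable_continuous_supported (r := r)); first exact: cM.
  by move=> x rx; rewrite dphir// mulr0.
have i2 : mu.-integrable setT (EFin \o (fun x => w x * phi x)).
  apply: (integrable_continuous_supported (r := r)); first exact: cM.
  by move=> x rx; rewrite phir// mulr0.
apply/eqP; rewrite -addr_eq0; apply/eqP; rewrite -RintegralD//.
apply: (Rintegral_partial_eq0 (j := j) (f := fun x => v x * phi x) (r := r)).
- exact: cM.
- by move=> x; exact: (continuousD (cM _ _ cv cdphi x) (cM _ _ cw cphi x)).
- move=> x; have := vw x => vwx; have dphix := dphi x.
  have [h1 h2] := vwx; have [h3 h4] := dphix.
  apply: DeriveDef; first exact: (derivableM h1 h3).
  by rewrite (deriveM h1 h3) h2 h4; congr (_ + _); exact: mulrC.
- by move=> x rx; rewrite phir// mulr0.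
Qed.

End IntegrationByParts.

(** * Smooth bumps on the line built from [exp(-1/t)] *)

Section SmoothBump.
Context {R : realType}.
Implicit Types (f g : R -> R) (P Q : {poly R}) (a b s t : R).

(** Existence of [n] successive derivatives. Smoothness is expressed as [Ck n f] for all [n], the
    continuity of each derivative coming from the existence of the next. *)
Fixpoint Ck n f : Prop :=
  if n is m.+1 then (forall t, derivable f t 1) /\ Ck m f^`()%classic else True.

Lemma CkW n f : Ck n.+1 f -> Ck n f.
Proof. by elim: n f => [//|n IHn] f [df [ddf Cf]]; split=> //; apply: IHn. Qed.

Lemma CkD n f g : Ck n f -> Ck n g -> Ck n (f \+ g).
Proof.
elim: n f g => [//|n IHn] f g [df Cf] [dg Cg]; split=> [t|].
  exact: derivableD.
have -> : (f \+ g)^`()%classic = f^`()%classic \+ g^`()%classic.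
  by apply/funext => t; rewrite /= !derive1E deriveD.
exact: IHn.
Qed.

Lemma CkM n f g : Ck n f -> Ck n g -> Ck n (f \* g).
Proof.
elim: n f g => [//|n IHn] f g Cf Cg; have [df Cf'] := Cf; have [dg Cg'] := Cg.
split=> [t|]; first exact: derivableM.
have -> : (f \* g)^`()%classic = (f \* g^`()%classic) \+ (g \* f^`()%classic).
  by apply/funext => t; rewrite /= !derive1E deriveM.
by apply: CkD; apply: IHn => //; exact: CkW.
Qed.

Lemma Ck_cst n a : Ck n (cst a).
Proof.
elim: n a => [//|n IHn] a; split=> [t|]; first exact: derivable_cst.
have -> : (cst a : R -> R)^`()%classic = cst 0 by apply/funext => t; rewrite derive1_cst.
exact: IHn.
Qed.

Lemma Ck_affine n f a b : Ck n f -> Ck n (fun t => f (a * t + b)).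
Proof.
elim: n f => [//|n IHn] f [df Cf].
have dl t : is_derive t 1 (fun t : R => a * t + b) a.
  apply: (is_derive_eq (is_deriveD (is_deriveZ a (is_derive_id t (1 : R)))
    (is_derive_cst b t (1 : R)))).
  by rewrite addr0; exact: mulr1.
have dfl t : is_derive t 1 (fun t => f (a * t + b)) (f^`()%classic (a * t + b) * a).
  apply: (is_derive1_comp (f := f)).
  by rewrite derive1E; exact/derivableP/df.
split=> [t|]; first by have [] := dfl t.
have -> : (fun t => f (a * t + b))^`()%classic =
    cst a \* (fun t => f^`()%classic (a * t + b)).
  by apply/funext => t; rewrite derive1E [LHS]derive_val mulrC.
by apply: CkM; [exact: Ck_cst|exact: IHn].
Qed.

Lemma Ck_continuous f : Ck 1 f -> continuous f.
Proof.
by move=> [df _] t; exact/differentiable_continuous/derivable1_diffP.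
Qed.

(** With an arbitrary polynomial [P] in [1/t] the family is closed under differentiation; [psi 1] is
    the classical function that is flat at 0. *)
Definition psi P t : R := if 0 < t then P.[t^-1] * expR (- t^-1) else 0.

(** Leaving the rate [1/k] free makes the induction on the polynomial work: [exp(s/k)] splits into
    two factors [exp(s/(2k))], one bounding the smaller polynomial and the other, by
    [1 + x <= exp x], the extra factor [s]. *)
Lemma horner_le_expR P k : (0 < k)%N ->
  exists K, forall s, 0 <= s -> `|P.[s]| <= K * expR (s / k%:R).
Proof.
elim/poly_ind: P k => [|P c IHP] k k0.
  by exists 0 => s s0; rewrite horner0 normr0 mul0r.
have [K PK] := IHP k.*2 (etrans (double_gt0 _) k0).
exists (K * k.*2%:R + `|c|) => s s0.
have k2 : (0 : R) < k.*2%:R by rewrite ltr0n double_gt0.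
rewrite hornerMXaddC (le_trans (ler_normD _ _))// mulrDl lerD//; last first.
  by rewrite ler_peMr// -expR0 ler_expR divr_ge0.
have -> : expR (s / k%:R) = expR (s / k.*2%:R) * expR (s / k.*2%:R).
  rewrite -expRD; congr expR; rewrite -mul2n natrM; field.
  by rewrite pnatr_eq0 -lt0n.
rewrite normrM (ger0_norm s0).
have -> : forall x y : R, K * k.*2%:R * (x * y) = (K * x) * (k.*2%:R * y).
  by move=> x y; ring.
apply: ler_pM => //; first exact: PK.
rewrite -ler_pdivrMl// mulrC (le_trans _ (expR_ge1Dx _))//.
by rewrite lerDr.
Qed.

(** This is the exponential bound for ['X^2 * P] at [s = 1/t] with rate 1. Quadratic decay is what
    makes the derivative at 0 vanish. *)
Lemma psi_le_sqr P : exists K, forall t, `|psi P t| <= K * t ^+ 2.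
Proof.
have [K PK] := horner_le_expR ('X^2 * P) (ltn0Sn 0).
have K0 : 0 <= K.
  have := PK 0 (lexx _); rewrite mul0r expR0 mulr1; exact: le_trans.
exists K => t; rewrite /psi; case: ifPn => t0; last first.
  by rewrite normr0 mulr_ge0// sqr_ge0.
have ti : 0 <= t^-1 by rewrite invr_ge0 ltW.
have h : t^-1 ^+ 2 * `|P.[t^-1]| <= K * expR t^-1.
  by have := PK _ ti; rewrite divr1 hornerM hornerXn normrM (ger0_norm (exprn_ge0 _ ti)).
rewrite normrM (ger0_norm (expR_ge0 _)) expRN ler_pdivrMr ?expR_gt0//.
have -> : `|P.[t^-1]| = t ^+ 2 * (t^-1 ^+ 2 * `|P.[t^-1]|).
  by rewrite mulrA exprVn divff ?mul1r// expf_neq0// gt_eqF.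
have -> : K * t ^+ 2 * expR t^-1 = t ^+ 2 * (K * expR t^-1) by ring.
by rewrite ler_wpM2l// sqr_ge0.
Qed.

(** For [t > 0] and [s = 1/t] the product and chain rules give [s^2 (P(s) - P'(s)) exp(-s)]. For
    [t < 0] the function is locally zero. At 0 the difference quotient is at most [|K| |h|] by
    [psi_le_sqr]. *)
Lemma is_derive_psi P t : is_derive t 1 (psi P) (psi ('X^2 * (P - P^`())) t).
Proof.
have [t0|t0|->] := ltgtP t 0.
- rewrite [X in is_derive _ _ _ X]/psi ltNge (ltW t0)/=.
  apply: near_eq_is_derive (is_derive_cst 0 t 1).
  by near do rewrite /psi ltNge ltW//=; exact: lt_nbhsl.
- rewrite [X in is_derive _ _ _ X]/psi t0.
  have tn0 : t != 0 by rewrite gt_eqF.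
  have dinv : is_derive t 1 (fun s : R => s^-1) (- t ^- 2).
    apply: is_derive_eq; first exact: (is_deriveV (f := id)).
    by rewrite [_ *: _]mulr1.
  have dP : is_derive t 1 (fun s : R => P.[s^-1]) (P^`().[t^-1] * - t ^- 2).
    have dh : derivable (horner P) t^-1 1 by exact: derivable_horner.
    have dP' : is_derive t^-1 1 (horner P) P^`().[t^-1].
      by rewrite derivE derive1E; exact/derivableP.
    exact: (is_derive1_comp dP' dinv).
  have dE : is_derive t 1 (fun s : R => expR (- s^-1)) (expR (- t^-1) * - - t ^- 2).
    exact: (is_derive1_comp (f := expR) (is_derive_expR _) (is_deriveN dinv)).
  apply: near_eq_is_derive.
    near=> s; rewrite /psi ifT; last by near: s; exact: lt_nbhsr.
    by reflexivity.
  apply: (is_derive_eq (is_deriveM dP dE)).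
  rewrite !hornerE/= /GRing.scale/=; field.
  exact: tn0.
- rewrite [X in is_derive _ _ _ X]/psi ltxx.
  have [K PK] := psi_le_sqr P.
  suff h : (fun h : R => h^-1 *: ((psi P \o shift 0) (h *: 1) - psi P 0)) @ 0^' --> (0 : R).
    by apply: DeriveDef; [apply/cvg_ex; exists 0|exact: cvg_lim].
  have psi0 : psi P 0 = 0 by rewrite /psi ltxx.
  have g0 : (fun h : R => `|K| * `|h|) @ 0^' --> `|K| * `|0 : R|.
    by apply: cvg_within_filter; apply: cvgM; [exact: cvg_cst|exact: norm_continuous].
  rewrite normr0 mulr0 in g0.
  apply/norm_cvg0P; apply: squeeze_cvgr g0; last exact: cvg_cst.
  near=> h.
  rewrite normr_ge0/= psi0 subr0 addr0 [h *: 1]mulr1 normrM normfV.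
  have h0 : 0 < `|h| by rewrite normr_gt0; near: h; exact: nbhs_dnbhs_neq.
  rewrite ler_pdivrMl// (le_trans (PK h))//.
  have -> : `|h| * (`|K| * `|h|) = `|K| * h ^+ 2.
    by rewrite -(real_normK (num_real h)); ring.
  by rewrite ler_wpM2r ?sqr_ge0 ?ler_norm.
Unshelve. all: by end_near. Qed.

Lemma psi_Ck P n : Ck n (psi P).
Proof.
elim: n P => [//|n IHn] P; split=> [t|]; first by have [] := is_derive_psi P t.
have -> : (psi P)^`()%classic = psi ('X^2 * (P - P^`())) by
  apply/funext => t; rewrite derive1E; have [] := is_derive_psi P t.
exact: IHn.
Qed.

(** The factor [n] steepens the edges: the function vanishes off []a, b[] for every [n], while its
    values inside tend to 1. *)
Definition itv_bump n a b t : R := psi 1 (n%:R * t - n%:R * a) * psi 1 (n%:R * b - n%:R * t).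

Lemma itv_bump_Ck n a b m : Ck m (itv_bump n a b).
Proof.
apply: (@CkM _ (fun t => psi 1 (n%:R * t - n%:R * a))).
  exact: Ck_affine (psi_Ck _ _).
have -> : (fun t => psi 1 (n%:R * b - n%:R * t)) =
    (fun t => psi 1 ((- n%:R) * t + n%:R * b)).
  by apply/funext => t; rewrite mulNr addrC.
exact: Ck_affine (psi_Ck _ _).
Qed.

Lemma psi1E t : psi 1 t = if 0 < t then expR (- t^-1) else 0.
Proof. by rewrite /psi hornerE mul1r. Qed.

Lemma psi1_ge0 t : 0 <= psi 1 t.
Proof. by rewrite psi1E; case: ifP => // _; exact: expR_ge0. Qed.

Lemma psi1_le1 t : psi 1 t <= 1.
Proof.
rewrite psi1E; case: ifP => // t0; rewrite -expR0 ler_expR oppr_le0 invr_ge0.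
exact: ltW.
Qed.

Lemma itv_bump_ge0 n a b t : 0 <= itv_bump n a b t.
Proof. by rewrite mulr_ge0// psi1_ge0. Qed.

Lemma itv_bump_le1 n a b t : itv_bump n a b t <= 1.
Proof. by rewrite mulr_ile1 ?psi1_ge0 ?psi1_le1. Qed.

Lemma itv_bump_out n a b t : t \notin `]a, b[ -> itv_bump n a b t = 0.
Proof.
rewrite in_itv/= negb_and -!leNgt /itv_bump !psi1E -!mulrBr.
have h s : s <= 0 -> (0 < n%:R * s) = false.
  by move=> s0; apply/negbTE; rewrite -leNgt mulr_ge0_le0.
by move=> /orP[]; rewrite -subr_le0 => /h ->; rewrite ?mul0r ?mulr0.
Qed.

Lemma itv_bump_gt0 a b t : t \in `]a, b[ -> 0 < itv_bump 1 a b t.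
Proof.
rewrite in_itv/= => /andP[ta bt]; rewrite /itv_bump !psi1E !mul1r !subr_gt0 ta bt.
by apply: mulr_gt0; exact: expR_gt0.
Qed.

Lemma psi1_cvg1 t : 0 < t -> (fun n => psi 1 (n%:R * t)) @ \oo --> (1 : R).
Proof.
move=> t0.
have h : (fun n : nat => expR (- (n.+1%:R^-1 * t^-1))) @ \oo --> (1 : R).
  rewrite -[X in _ --> X](@expR0 R) -[X in _ --> expR X]oppr0 -[X in _ --> expR (- X)](mul0r t^-1).
  apply: continuous_cvg; first exact: continuous_expR.
  by apply: cvgN; apply: cvgMl; exact: cvg_harmonic.
(* At [n = 0] the value is 0, so the limit is taken from [n = 1] on, where the argument is positive
   and the exponential formula holds. *)
rewrite -(cvg_shiftS _).
apply: cvg_trans h; apply: near_eq_cvg; near=> n.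
by rewrite /= psi1E mulr_gt0// invfM.
Unshelve. all: by end_near. Qed.

Lemma itv_bump_cvg a b t :
  (fun n => itv_bump n a b t) @ \oo --> (\1_`]a, b[%classic t : R).
Proof.
rewrite indicE; have [tab|tab] := boolP (t \in `]a, b[).
  rewrite mem_set//=; move: tab; rewrite in_itv/= => /andP[ta bt].
  rewrite -[X in _ --> X](mulr1 1); apply: cvgM.
    under eq_fun do rewrite -mulrBr; apply: psi1_cvg1; by rewrite subr_gt0.
  under eq_fun do rewrite -mulrBr; apply: psi1_cvg1; by rewrite subr_gt0.
rewrite memNset; last exact/negP.
by under eq_fun do rewrite itv_bump_out//; exact: cvg_cst.
Qed.

End SmoothBump.

(** * Products of one-variable functions as test functions *)

Section Tensor.
Context {R : realType} {d : nat}.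
Local Notation cV := 'cV[R]_d.
Local Notation e j := (delta_mx j 0 : cV).
Implicit Types (f : 'I_d -> R -> R) (j : 'I_d).

Definition tensor f (x : cV) : R := \prod_i f i (x i 0).

Definition tensor_factors_partial j f : 'I_d -> R -> R :=
  fun i => if i == j then (f i)^`()%classic else f i.

(** Along [e j] only the [j]-th factor varies; the product [c] of the others is constant. *)
Lemma tensor_is_derive j f (x : cV) : (forall t, derivable (f j) t 1) ->
  is_derive x (e j) (tensor f) (tensor (tensor_factors_partial j f) x).
Proof.
move=> df; apply/is_derive_slice0.
pose c : R := \prod_(i | i != j) f i (x i 0).
have -> : (fun s : R => tensor f (s *: e j + x)) = cst c \* (fun s => f j (s + x j 0)).
  apply/funext => s; rewrite /tensor (bigD1 j)//= mulrC !mxE !eqxx mulr1.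
  congr (_ * _); apply: eq_bigr => i ij.
  by rewrite !mxE (negbTE ij) mulr0 add0r.
have ds : is_derive (0 : R) (1 : R) (fun s : R => f j (s + x j 0)) ((f j)^`()%classic (x j 0) * 1).
  apply: (is_derive1_comp (f := f j) (g := fun s => s + x j 0)).
    by rewrite add0r derive1E; exact/derivableP/df.
  exact: is_derive_shift.
apply: (is_derive_eq (is_deriveM (is_derive_cst c (0 : R) (1 : R)) ds)).
rewrite scaler0 addr0 mulr1 /tensor (bigD1 j)//= /tensor_factors_partial eqxx mulrC.
by congr (_ * _); apply: eq_bigr => i /negbTE ->.
Qed.

Lemma tensor_continuous f : (forall i, continuous (f i)) -> continuous (tensor f).
Proof.
move=> cf.
suff h (s : seq 'I_d) : continuous (fun x : cV => \prod_(i <- s) f i (x i 0)) by exact: h.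
elim: s => [|i s IHs] x.
  have -> : (fun x : cV => \prod_(i <- [::]) f i (x i 0)) = cst 1.
    by apply/funext => y; rewrite big_nil.
  exact: cst_continuous.
have -> : (fun x : cV => \prod_(i <- i :: s) f i (x i 0)) =
    (fun x : cV => f i (x i 0)) \* (fun x : cV => \prod_(i <- s) f i (x i 0)).
  by apply/funext => y; rewrite big_cons.
apply: continuousM; last exact: IHs.
by apply: continuous_comp; [exact: coord_cts|exact: cf].
Qed.

Lemma tensor_factors_partial_Ck j f :
  (forall i n, Ck n (f i)) -> forall i n, Ck n (tensor_factors_partial j f i).
Proof.
move=> Cf i n; rewrite /tensor_factors_partial; case: ifP => // _.
by have [] := Cf i n.+1.
Qed.

Lemma tensor_partial j f : (forall i n, Ck n (f i)) ->
  partial j (tensor f) = tensor (tensor_factors_partial j f).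
Proof.
move=> Cf; apply/funext => x.
have dfj t : derivable (f j) t 1 by have [] := Cf j 1%N.
by have [] := tensor_is_derive x dfj.
Qed.

(** A partial derivative of a product of smooth one-variable functions is again such a product, so
    by induction all iterated partials are, and these are continuous and differentiable along each
    axis. *)
Lemma tensor_smooth f : (forall i n, Ck n (f i)) -> smooth (tensor f).
Proof.
move=> Cf s.
have [g Cg ->] : exists2 g, forall i n, Ck n (g i) & iter_partial s (tensor f) = tensor g.
  elim: s => [|j s [g Cg IHs]]; first by exists f.
  exists (tensor_factors_partial j g); first exact: tensor_factors_partial_Ck.
  by rewrite /iter_partial/= -/(iter_partial s _) IHs tensor_partial.
split=> [|j x].
  by apply: tensor_continuous => i; apply: Ck_continuous; exact: Cg.
have dgj t : derivable (g j) t 1 by have [] := Cg j 1%N.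
by have [] := tensor_is_derive x dgj.
Qed.

Definition box_bump n (a b : 'I_d -> R) : cV -> R := tensor (fun i => itv_bump n (a i) (b i)).

Lemma box_bump_ge0 n a b x : 0 <= box_bump n a b x.
Proof. by apply: prodr_ge0 => i _; exact: itv_bump_ge0. Qed.

Lemma box_bump_le1 n a b x : box_bump n a b x <= 1.
Proof. by apply: prodr_ile1 => i _; rewrite itv_bump_ge0 itv_bump_le1. Qed.

Lemma box_bump_out n a b x : ~ obox a b x -> box_bump n a b x = 0.
Proof.
move=> /existsNP[i /negP xi].
by rewrite /box_bump /tensor (bigD1 i)//= itv_bump_out// mul0r.
Qed.

Lemma box_bump_supported n a b r : 0 <= r ->
  (forall i, - r <= a i) -> (forall i, b i <= r) -> supported r (box_bump n a b).
Proof.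
move=> r0 ra br x rx; apply: box_bump_out => xab; move: rx; apply/negP; rewrite -leNgt.
apply/col_norm_le => // i; have := xab i; rewrite in_itv/= => /andP[ax xb].
by rewrite ler_norml (le_trans (ra i) (ltW ax)) (le_trans (ltW xb) (br i)).
Qed.

Lemma smooth_supported_test_function (phi : cV -> R) r :
  smooth phi -> supported r phi -> test_function phi.
Proof.
move=> sphi phir; split=> //.
apply: subclosed_compact (@compact_norm_le R d r) _; first exact: closed_closure.
have /closure_id -> : closed [set x : cV | `|x| <= r] by exact: closed_norm_le.
apply: closure_subset => x /= /eqP phix; rewrite leNgt; apply/negP => /phir.
exact: phix.
Qed.

Lemma box_bump_test_function n a b : test_function (box_bump n a b).
Proof.
pose r := \big[Num.max/0]_i (Num.max `|a i| `|b i|) : R.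
have hr i : Num.max `|a i| `|b i| <= r.
  exact: (le_bigmax _ (fun i => Num.max `|a i| `|b i|) i).
apply: (@smooth_supported_test_function _ r).
  by apply: tensor_smooth => i k; exact: itv_bump_Ck.
apply: box_bump_supported.
- exact: bigmax_ge_id.
- move=> i; have := hr i; rewrite ge_max => /andP[+ _].
  by rewrite ler_norml => /andP[].
- move=> i; have := hr i; rewrite ge_max => /andP[_].
  by rewrite ler_norml => /andP[].
Qed.

Lemma box_bump_cvg a b x :
  (fun n => box_bump n a b x) @ \oo --> (\1_(obox a b) x : R).
Proof.
have -> : \1_(obox a b) x = \prod_i \1_`]a i, b i[%classic (x i 0) :> R.
  rewrite indicE; have [xab|xab] := boolP (x \in obox a b).
    rewrite big1// => i _; rewrite indicE mem_set//=.
    by move: xab; rewrite inE => /(_ i).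
  move: xab; rewrite notin_setE => /existsNP[i xi].
  by rewrite (bigD1 i)//= indicE memNset ?mul0r.
suff h (s : seq 'I_d) : (fun n => \prod_(i <- s) itv_bump n (a i) (b i) (x i 0)) @ \oo -->
    (\prod_(i <- s) \1_`]a i, b i[%classic (x i 0) : R) by exact: h.
elim: s => [|i s IHs].
  have -> : (fun n => \prod_(i <- [::]) itv_bump n (a i) (b i) (x i 0)) = cst (1 : R).
    by apply/funext => n; rewrite big_nil.
  by rewrite big_nil; exact: cvg_cst.
have -> : (fun n => \prod_(i <- i :: s) itv_bump n (a i) (b i) (x i 0)) =
    (fun n => itv_bump n (a i) (b i) (x i 0)) \*
    (fun n => \prod_(i <- s) itv_bump n (a i) (b i) (x i 0)) :> (nat -> R).
  by apply/funext => n; rewrite big_cons.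
by rewrite big_cons; apply: cvgM => //; exact: itv_bump_cvg.
Qed.

End Tensor.

(** * The fundamental lemma of the calculus of variations *)

Section FundamentalLemma.
Context {R : realType} {d : nat}.
Local Notation cV := 'cV[R]_d.
Local Notation mu := (@lebesgue_col R d).
Variable h : cV -> R.
Hypothesis mh : measurable_fun setT h.
Hypothesis ih : forall r, mu.-integrable [set x : cV | `|x| <= r] (EFin \o h).
Hypothesis h_test : forall phi, test_function phi ->
  (\int[mu]_x (h x * phi x)%:E = 0)%E.

Let mhE : measurable_fun setT (EFin \o h).
Proof. exact/measurable_EFinP. Qed.

Let integrable_obox a b : mu.-integrable (obox a b) (EFin \o h).
Proof.
pose r := \big[Num.max/0]_i (Num.max `|a i| `|b i|) : R.
have hr i : Num.max `|a i| `|b i| <= r.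
  exact: (le_bigmax _ (fun i => Num.max `|a i| `|b i|) i).
apply: integrableS (ih r); [exact: measurable_norm_le|exact: measurable_obox|].
move=> x xab /=; apply/col_norm_le => [|i]; first exact: bigmax_ge_id.
have := xab i; have := hr i; rewrite ge_max in_itv/= => /andP[+ +] /andP[ax xb].
rewrite !ler_norml => /andP[ra _] /andP[_ br].
by rewrite (le_trans ra (ltW ax)) (le_trans (ltW xb) br).
Qed.

(** The functions [box_bump n a b] are test functions with values in [0, 1] that vanish off the box
    and tend to its indicator; [|h|] cut off to the box dominates the products. *)
Let integral_obox0 a b : (\int[mu]_(x in obox a b) (h x)%:E = 0)%E.
Proof.
have mab : measurable (obox a b : set cV) by exact: measurable_obox.
have ihab := (integrable_mkcond (EFin \o h) mab).1 (integrable_obox a b).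
rewrite integral_mkcond.
have mF n : measurable_fun setT (fun x => (h x * box_bump n a b x)%:E).
  apply/measurable_EFinP/measurable_funM => //; apply: continuous_measurable_col.
  exact/smooth_continuous/(box_bump_test_function n a b).1.
have cvgF : {ae mu, forall x, setT x ->
    (fun n => (h x * box_bump n a b x)%:E) @ \oo --> ((EFin \o h) \_ (obox a b)) x}.
  apply: aeW => x _.
  have -> : ((EFin \o h) \_ (obox a b)) x = (h x * \1_(obox a b) x)%:E.
    by rewrite patchE indicE; case: ifPn => _; rewrite ?mulr1 ?mulr0.
  apply: cvg_EFin; first by apply: nearW.
  apply: (cvgM (f := cst (h x))); first exact: cvg_cst.
  exact: box_bump_cvg.
have domF : {ae mu, forall x n, setT x ->
    (`|(h x * box_bump n a b x)%:E| <= (abse \o ((EFin \o h) \_ (obox a b))) x)%E}.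
  apply: aeW => x n _ /=; rewrite patchE; case: ifPn => xab /=.
    rewrite lee_fin normrM (ger0_norm (box_bump_ge0 _ _ _ _)).
    by rewrite ler_piMr// box_bump_le1.
  rewrite box_bump_out ?mulr0 ?normr0//.
  by move: xab; rewrite notin_setE.
have [_ _] := dominated_convergence measurableT mF (measurable_int _ ihab) cvgF
  (integrable_abse ihab) domF.
have -> : [sequence (\int[mu]_x (h x * box_bump n a b x)%:E)%E]_n = cst 0%E.
  by apply/funext => n; apply: h_test; exact: box_bump_test_function.
by move=> h1; apply/esym; apply: cvg_unique h1 => //; exact: cvg_cst.
Qed.

Let B n : set cV := obox (fun=> - n%:R) (fun=> n%:R).

Let mB n : measurable (B n). Proof. exact: measurable_obox. Qed.

(** The sets with this property include the boxes and form a Dynkin class. Intersecting with [B n]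
    keeps [h] integrable, as the steps for complements and disjoint unions require. *)
Let integral_setI_box0 n (A : set cV) : measurable A ->
  (\int[mu]_(x in A `&` B n) (h x)%:E = 0)%E.
Proof.
have iB C : measurable C -> mu.-integrable (C `&` B n) (EFin \o h).
  move=> mC; apply: (integrableS (mB n)) (integrable_obox _ _).
  - exact: measurableI.
  - exact: subIsetr.
pose P (C : set cV) := (\int[mu]_(x in C `&` B n) (h x)%:E = 0)%E.
move=> mA; have : <<s [set (obox a b : set cV) | a in setT & b in setT] >> A.
  exact: (eq_ind _ (fun S => S A) mA _ obox_gen).
apply: (dynkin_induction (P := P) obox_gen obox_setI_closed); rewrite {}/P {A mA}.
- by rewrite setTI; exact: integral_obox0.
- by move=> _ [a _ [b _ <-]]; rewrite /B obox_setI; exact: integral_obox0.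
- move=> S mS S0; have mCS := measurableC mS.
  have := integral_obox0 (fun=> - n%:R) (fun=> n%:R).
  rewrite -/(B n) -[in X in X -> _](setTI (B n)) -(setUv S) setIUl.
  rewrite integral_setU ?S0 ?add0e//; [exact: measurableI|exact: measurableI| |].
  + by apply: measurable_funTS.
  + by apply/disj_setPS => x [[Sx _] [/(_ Sx)]].
- move=> F mF tF F0; rewrite setI_bigcupl integral_bigcup.
  + by rewrite eseries0// => k _ _; exact: F0.
  + apply/trivIsetP => i j _ _ ij; rewrite setIACA.
    by move/trivIsetP : tF => /(_ i j I I ij) ->; rewrite set0I.
  + by move=> k; apply: measurableI.
  + rewrite -setI_bigcupl; apply: iB; exact: bigcupT_measurable.
Qed.

(** Zero integral over each measurable subset of [B n] forces [h = 0] almost everywhere on [B n],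
    and countably many [B n] exhaust the space. *)
Lemma ae_eq0_of_test_functions : {ae mu, forall x, h x = 0}.
Proof.
have hB n : ae_eq mu (B n) (EFin \o h) (cst 0%E).
  apply: integral_ae_eq => //; first exact: integrable_obox.
  move=> E EB mE; rewrite integral0.
  by have := integral_setI_box0 n mE; rewrite (setIidl EB).
have : {ae mu, forall x n, B n x -> (h x)%:E = 0%E}.
  apply/ae_foralln => n; exact: hB.
apply: filterS => x hx.
have [n xn] : exists n, `|x| < n%:R.
  by exists (Num.truncn `|x|).+1; exact: truncnS_gt.
suff /hx[] : B n x by [].
move=> i; rewrite in_itv/= -ltr_norml.
exact: le_lt_trans (coord_le_norm _ _) xn.
Qed.

End FundamentalLemma.

(** * Weak partial derivatives: almost everywhere uniqueness and the classical case *)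

Section WeakPartial.
Context {R : realType} {d : nat}.
Local Notation cV := 'cV[R]_d.
Local Notation mu := (@lebesgue_col R d).
Local Notation e j := (delta_mx j 0 : cV).
Local Notation Re := (@complex.Re R).
Local Notation Im := (@complex.Im R).
Implicit Types (u g : cV -> R[i]) (j : 'I_d).

Lemma normcE (z : R[i]) : normc z = Num.sqrt (Re z ^+ 2 + Im z ^+ 2).
Proof. by case: z. Qed.

Lemma normc_sqrE (z : R[i]) : normc z ^+ 2 = Re z ^+ 2 + Im z ^+ 2.
Proof. by rewrite normcE sqr_sqrtr// addr_ge0// sqr_ge0. Qed.

Lemma normc_ge0 (z : R[i]) : 0 <= normc z.
Proof. by rewrite normcE sqrtr_ge0. Qed.

Lemma ge_Re_normc (z : R[i]) : `|Re z| <= normc z.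
Proof. by rewrite -sqrtr_sqr normcE ler_sqrt ?lerDl ?addr_ge0 ?sqr_ge0. Qed.

Lemma ge_Im_normc (z : R[i]) : `|Im z| <= normc z.
Proof. by rewrite -sqrtr_sqr normcE ler_sqrt ?lerDr ?addr_ge0 ?sqr_ge0. Qed.

Lemma normc_le_ReIm (z : R[i]) : normc z <= `|Re z| + `|Im z|.
Proof.
rewrite -(ger0_norm (addr_ge0 (normr_ge0 (Re z)) (normr_ge0 (Im z)))) -sqrtr_sqr.
rewrite normcE ler_sqrt ?sqr_ge0// sqrrD !real_normK ?num_real//.
by rewrite lerD2r lerDl mulrn_wge0// mulr_ge0.
Qed.

Lemma ReMr (z : R[i]) (t : R) : Re (z * t%:C) = Re z * t.
Proof. by case: z => a b /=; rewrite mulr0 subr0. Qed.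

Lemma ImMr (z : R[i]) (t : R) : Im (z * t%:C) = Im z * t.
Proof. by case: z => a b /=; rewrite mulr0 add0r. Qed.

Lemma normc_measurable u : cmeasurable setT u ->
  measurable_fun setT (fun x => normc (u x)).
Proof.
move=> [mRe mIm].
have -> : (fun x => normc (u x)) = Num.sqrt \o (fun x => Re (u x) ^+ 2 + Im (u x) ^+ 2).
  by apply/funext => x /=; rewrite normcE.
apply: measurableT_comp.
  by apply: continuous_measurable_fun; exact: sqrt_continuous.
by apply: measurable_funD; apply: measurable_funX.
Qed.

(** The real and imaginary parts are bounded on a ball containing [K], and balls have finite
    measure. *)
Lemma locally_summable_continuous u :
  continuous (Re \o u) -> continuous (Im \o u) -> locally_summable u.
Proof.
move=> cRe cIm; have mu_ : cmeasurable setT u.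
  by split; exact: continuous_measurable_col.
split=> // K cK; have [r r0 Kr] := compact_sub_norm_le cK.
pose B := [set x : cV | `|x| <= r].
have [M1 _ RM] := continuous_bounded_norm_le r cRe.
have [M2 _ IM] := continuous_bounded_norm_le r cIm.
rewrite integral_mkcond.
apply: (@le_lt_trans _ _ (\int[mu]_x ((M1 + M2) * \1_B x)%:E)%E).
  apply: ge0_ae_le_integral_sup.
  - move=> x; rewrite patchE; case: ifPn => // _; rewrite lee_fin normc_ge0//.
  - move=> x; rewrite indicE lee_fin; have [|] := boolP (x \in B) => Bx.
      by rewrite mulr1 (le_trans _ (lerD (RM _ (set_mem Bx)) (IM _ (set_mem Bx)))) ?addr_ge0.
    by rewrite mulr0.
  - apply: aeW => x; rewrite patchE; case: ifPn => [/set_mem Kx|_]; last first.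
      rewrite lee_fin indicE; have [|] := boolP (x \in B) => Bx; last by rewrite mulr0.
      by rewrite mulr1 (le_trans _ (lerD (RM _ (set_mem Bx)) (IM _ (set_mem Bx)))) ?addr_ge0.
    have Bx := Kr _ Kx.
    rewrite lee_fin indicE mem_set// mulr1 (le_trans _ (lerD (RM _ Bx) (IM _ Bx)))//=.
    exact: normc_le_ReIm.
exact: integrable_lty (integrable_cst_norm_le _ _).
Qed.

Lemma integrable_test_product (f phi : cV -> R) : measurable_fun setT f ->
  (forall r, mu.-integrable [set x : cV | `|x| <= r] (EFin \o f)) ->
  test_function phi -> mu.-integrable setT (fun x => (f x * phi x)%:E).
Proof.
move=> mf fint tphi; have [r r0 phir] := test_function_supported tphi.
have cphi := smooth_continuous tphi.1.
have [M M0 phiM] := continuous_supported_bounded cphi phir.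
pose B := [set x : cV | `|x| <= r].
have mB : measurable B by exact: measurable_norm_le.
have ifM := (integrable_mkcond _ mB).1 (integrableZl mB M (fint r)).
apply: (le_integrable measurableT _ _ ifM).
  by apply/measurable_EFinP/measurable_funM => //; exact: continuous_measurable_col.
move=> x _; rewrite patchE; case: ifPn => Bx.
  by rewrite -EFinM lee_fin mulrC !normrM ler_wpM2r// (gtr0_norm M0).
rewrite phir ?mulr0//; move: Bx; rewrite notin_setE => /negP.
by rewrite -ltNge.
Qed.

Lemma locally_summable_integrable u r : locally_summable u ->
  mu.-integrable [set x : cV | `|x| <= r] (EFin \o (Re \o u)) /\
  mu.-integrable [set x : cV | `|x| <= r] (EFin \o (Im \o u)).
Proof.
move=> [mu_ su]; have [mRe mIm] := mu_.
have mB : measurable [set x : cV | `|x| <= r] by exact: measurable_norm_le.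
have iu : mu.-integrable [set x : cV | `|x| <= r] (fun x => (normc (u x))%:E).
  apply/integrableP; split.
    by apply/measurable_EFinP/measurable_funTS; exact: normc_measurable.
  under eq_integral do rewrite /= (ger0_norm (normc_ge0 _)).
  by apply: su; exact: compact_norm_le.
split; apply: (le_integrable mB _ _ iu) => //=.
- by apply/measurable_EFinP/measurable_funTS.
- by move=> x _; rewrite lee_fin (ger0_norm (normc_ge0 _)) ge_Re_normc.
- by apply/measurable_EFinP/measurable_funTS.
- by move=> x _; rewrite lee_fin (ger0_norm (normc_ge0 _)) ge_Im_normc.
Qed.

(** The fundamental lemma is applied to [f1 - f2]. Since [Rintegral] takes a finite part,
    integrability of both products is used to return to extended reals before subtracting. *)
Lemma ae_eq_of_test_functions (f1 f2 : cV -> R) :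
  measurable_fun setT f1 -> measurable_fun setT f2 ->
  (forall r, mu.-integrable [set x : cV | `|x| <= r] (EFin \o f1)) ->
  (forall r, mu.-integrable [set x : cV | `|x| <= r] (EFin \o f2)) ->
  (forall phi, test_function phi ->
    Rintegral mu setT (fun x => f1 x * phi x) =
    Rintegral mu setT (fun x => f2 x * phi x)) ->
  {ae mu, forall x, f1 x = f2 x}.
Proof.
move=> m1 m2 i1 i2 f12.
have : {ae mu, forall x, f1 x - f2 x = 0}.
  apply: ae_eq0_of_test_functions; first exact: measurable_funB.
    by move=> r; exact: (integrableB (measurable_norm_le r) (i1 r) (i2 r)).
  move=> phi tphi.
  have j1 := integrable_test_product m1 i1 tphi.
  have j2 := integrable_test_product m2 i2 tphi.
  have -> : (fun x => ((f1 x - f2 x) * phi x)%:E) =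
      (fun x => (f1 x * phi x)%:E - (f2 x * phi x)%:E)%E.
    by apply/funext => x; rewrite mulrBl EFinB.
  have k1 := integrable_fin_num measurableT j1.
  have k2 := integrable_fin_num measurableT j2.
  rewrite integralB//.
  have := congr1 EFin (f12 _ tphi); rewrite /Rintegral (fineK k1) (fineK k2) => ->.
  by rewrite subee.
by apply: filterS => x /eqP; rewrite subr_eq0 => /eqP.
Qed.

(** Test functions are real, so the complex identity splits into one for the real parts and one for
    the imaginary parts. *)
Lemma weak_partial_unique j u g1 g2 : is_weak_partial j u g1 ->
  is_weak_partial j u g2 -> {ae mu, forall x, g1 x = g2 x}.
Proof.
move=> [_ s1 w1] [_ s2 w2]; have [[mR1 mI1] _] := s1; have [[mR2 mI2] _] := s2.
have w12 phi : test_function phi ->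
    cintegral mu setT (fun x => g1 x * (phi x)%:C) =
    cintegral mu setT (fun x => g2 x * (phi x)%:C).
  by move=> tphi; apply: oppr_inj; rewrite -w1// -w2.
have hR : {ae mu, forall x, Re (g1 x) = Re (g2 x)}.
  apply: ae_eq_of_test_functions => // [r|r|phi tphi].
  - by have [] := locally_summable_integrable r s1.
  - by have [] := locally_summable_integrable r s2.
  - have := congr1 Re (w12 _ tphi); rewrite /cintegral /=.
    by under eq_Rintegral do rewrite ReMr; under [in X in _ = X -> _]eq_Rintegral do rewrite ReMr.
have hI : {ae mu, forall x, Im (g1 x) = Im (g2 x)}.
  apply: ae_eq_of_test_functions => // [r|r|phi tphi].
  - by have [] := locally_summable_integrable r s1.
  - by have [] := locally_summable_integrable r s2.
  - have := congr1 Im (w12 _ tphi); rewrite /cintegral /=.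
    by under eq_Rintegral do rewrite ImMr; under [in X in _ = X -> _]eq_Rintegral do rewrite ImMr.
apply: filterS2 hR hI => x; case: (g1 x) (g2 x) => [a b] [a' b'] /=.
by move=> -> ->.
Qed.

Lemma is_weak_partial_classical j u g :
  continuous (Re \o u) -> continuous (Im \o u) ->
  continuous (Re \o g) -> continuous (Im \o g) ->
  (forall x, is_derive x (e j) (Re \o u) (Re (g x))) ->
  (forall x, is_derive x (e j) (Im \o u) (Im (g x))) ->
  is_weak_partial j u g.
Proof.
move=> cRu cIu cRg cIg dR dI; split; [exact: locally_summable_continuous..|].
move=> phi tphi; rewrite /cintegral.
have oppE (a b : R) : - (a +i* b) = (- a) +i* (- b) by [].
have -> : (fun x => Re (u x * (partial j phi x)%:C)) = (fun x => Re (u x) * partial j phi x).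
  by apply/funext => x; rewrite ReMr.
have -> : (fun x => Im (u x * (partial j phi x)%:C)) = (fun x => Im (u x) * partial j phi x).
  by apply/funext => x; rewrite ImMr.
have -> : (fun x => Re (g x * (phi x)%:C)) = (fun x => Re (g x) * phi x).
  by apply/funext => x; rewrite ReMr.
have -> : (fun x => Im (g x * (phi x)%:C)) = (fun x => Im (g x) * phi x).
  by apply/funext => x; rewrite ImMr.
rewrite oppE; congr (_ +i* _).
  exact: (integral_mul_partial cRu cRg dR).
exact: (integral_mul_partial cIu cIg dI).
Qed.

(** [weak_partial] is a choice made by [xget]; once some weak partial exists the chosen function is
    one too, and uniqueness compares the two. *)
Lemma weak_partial_ae j u g : is_weak_partial j u g ->
  {ae mu, forall x, weak_partial j u x = g x}.
Proof.
move=> w; apply: (weak_partial_unique _ w).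
by apply: (@xgetPex _ (cst 0) [set g | is_weak_partial j u g]); exists g.
Qed.

End WeakPartial.

(** * Bound on the nonlinear potential from the growth of [N] *)

Section PotentialBound.
Context {R : realType} {d : nat}.
Variables (N : 'cV[R]_d -> R[i] -> R[i]) (C0 p : R).
Hypothesis C0_gt0 : 0 < C0.
Hypothesis p_ge0 : 0 <= p.
Hypothesis N_growth : forall x v, normc (N x v) <= C0 * (normc v + normc v `^ p).

Lemma normc_real (s : R) : normc s%:C = `|s|.
Proof. by rewrite /= expr0n addr0 sqrtr_sqr. Qed.

(** The integrand is compared with plus and minus [B * \1_D] through [le_Rintegral_sup], which asks
    nothing of [f] beyond the bound. *)
Lemma Rintegral_itv_norm_le (f : R -> R) (r B : R) : 0 <= r ->
  (forall s, s \in `[0, r] -> `|f s| <= B) ->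
  `|Rintegral lebesgue_measure `[0, r]%classic f| <= r * B.
Proof.
move=> r0 fB; have B0 : 0 <= B.
  by apply: le_trans (fB 0 _); rewrite ?in_itv/= ?lexx.
rewrite Rintegral_mkcond; set D := `[0, r]%classic.
have mD : measurable D by exact: measurable_itv.
have muD : lebesgue_measure D = r%:E.
  by rewrite lebesgue_measure_itv/= lte_fin; case: ltP => [_|r0']; rewrite -?EFinB ?subr0//;
    congr EFin; apply/le_anti; rewrite r0 r0'.
have iD : lebesgue_measure.-integrable setT (EFin \o (\1_D : R -> R)).
  exact: integrable_indic_itv.
have iK : lebesgue_measure.-integrable setT (EFin \o (fun s : R => B * \1_D s)).
  by have := integrableZl measurableT B iD; apply: eq_integrable.
have intK k : Rintegral lebesgue_measure setT (fun s => k * (B * \1_D s)) = k * (r * B).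
  rewrite RintegralZl//; congr (_ * _); rewrite RintegralZl//.
  by rewrite mulrC; congr (_ * _); rewrite /Rintegral integral_indic// setIT [X in fine X]muD.
have fK s : `|(f \_ D) s| <= B * \1_D s.
  rewrite patchE indicE; case: ifPn => sD; last by rewrite normr0 mulr0.
  by rewrite mulr1; apply: fB; exact: set_mem.
have K0 s : 0 <= B * \1_D s by rewrite mulr_ge0// indicE ler0n.
rewrite ler_norml -(mulN1r (r * B)) -[X in _ && (_ <= X)](mul1r (r * B)) -!intK.
have nK s : `|-1 * (B * \1_D s)| <= B * \1_D s by rewrite mulN1r normrN ger0_norm.
have pK s : `|1 * (B * \1_D s)| <= B * \1_D s by rewrite mul1r ger0_norm.
have fK2 s : -1 * (B * \1_D s) <= (f \_ D) s <= 1 * (B * \1_D s).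
  by rewrite mulN1r mul1r -ler_norml.
apply/andP; split; apply: (le_Rintegral_sup iK); apply: aeW => // s.
  by have /andP[] := fK2 s.
by have /andP[] := fK2 s.
Qed.

(** At [z = q ^+ 2] the upper limit [Num.sqrt z] is [|q|]. On [[0, |q|]] the growth condition and
    [0 <= p] bound the modulus of [N] by [C0 * (M + M^p)]. *)
Lemma potential_norm_le x q M : `|q| <= M ->
  `|potential N x (q ^+ 2)| <= 2 * (`|q| * (C0 * (M + M `^ p))).
Proof.
move=> qM; rewrite /potential /potential_C /cintegral sqrtr_sqr.
have Re2 (z : R[i]) : complex.Re (2 * z) = 2 * complex.Re z.
  by rewrite !mulr_natl !mulr2n; case: z.
rewrite Re2 normrM ger0_norm// ler_wpM2l//=.
apply: Rintegral_itv_norm_le => // s; rewrite in_itv/= => /andP[s0 sq].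
have sM : s <= M by exact: le_trans qM.
rewrite (le_trans (ge_Re_normc _))// (le_trans (N_growth _ _))// normc_real ger0_norm//.
rewrite ler_wpM2l ?(ltW C0_gt0)// lerD// ge0_ler_powR ?nnegrE//.
exact: le_trans sM.
Qed.

End PotentialBound.

(** * Translated trial states with a magnetic phase and their energy *)

Section TrialFunction.
Context {R : realType} {d : nat}.
Local Notation cV := 'cV[R]_d.
Local Notation mu := (@lebesgue_col R d).
Local Notation e j := (delta_mx j 0 : cV).
Local Notation Re := (@complex.Re R).
Local Notation Im := (@complex.Im R).

Lemma continuous_sum_col (I : finType) (F : I -> cV -> R) :
  (forall i, continuous (F i)) -> continuous (fun x => \sum_i F i x).
Proof.
move=> cF.
suff h (s : seq I) : continuous (fun x : cV => \sum_(i <- s) F i x) by exact: h.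
elim: s => [|i s IHs] x.
  have -> : (fun x : cV => \sum_(i <- [::]) F i x) = cst 0.
    by apply/funext => y; rewrite big_nil.
  exact: cst_continuous.
have -> : (fun x : cV => \sum_(i <- i :: s) F i x) =
    (F i) \+ (fun x : cV => \sum_(i <- s) F i x).
  by apply/funext => y; rewrite big_cons.
by apply: continuousD; [exact: cF|exact: IHs].
Qed.

Lemma cont_mul (f g : cV -> R) : continuous f -> continuous g ->
  continuous (fun x => f x * g x).
Proof. by move=> cf cg x; exact: (continuousM (cf x) (cg x)). Qed.

Lemma cont_add (f g : cV -> R) : continuous f -> continuous g ->
  continuous (fun x => f x + g x).
Proof. by move=> cf cg x; exact: (continuousD (cf x) (cg x)). Qed.

Lemma cont_sub (f g : cV -> R) : continuous f -> continuous g ->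
  continuous (fun x => f x - g x).
Proof. by move=> cf cg x; exact: (continuousB (cf x) (cg x)). Qed.

Lemma cont_sqr (f : cV -> R) : continuous f -> continuous (fun x => f x ^+ 2).
Proof. by move=> cf; exact: cont_mul. Qed.

Lemma cont_cst (c : R) : continuous (fun _ : cV => c).
Proof. exact: cst_continuous. Qed.

Lemma cont_comp (f : cV -> R) (g : R -> R) : continuous f -> continuous g ->
  continuous (fun x => g (f x)).
Proof. by move=> cf cg x; apply: continuous_comp; [exact: cf|exact: cg]. Qed.

Lemma cont_shift (f : cV -> R) (a : cV) : continuous f ->
  continuous (fun x : cV => f (x - a)).
Proof.
move=> cf x U /cf /nbhs_ballP[r r0 rU]; apply/nbhs_ballP; exists r => // y.
rewrite -ball_normE /= => xy; apply: rU; rewrite -ball_normE /=.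
by rewrite opprB addrA subrK.
Qed.

Variables (Omega : 'I_d./2 -> R) (gamma : 'I_d -> R).
Local Notation A := (magnetic_potential Omega).
Local Notation V := (V_magnetic Omega gamma).

Lemma magnetic_potentialB x a j : A (x - a) j 0 = A x j 0 - A a j 0.
Proof. by rewrite /magnetic_potential mulmxBr !mxE. Qed.

Lemma magnetic_potential_continuous j : continuous (fun x : cV => A x j 0).
Proof.
have -> : (fun x : cV => A x j 0) = (fun x => \sum_i rotation_mx Omega j i * x i 0).
  by apply/funext => x; rewrite /magnetic_potential mxE.
by apply: continuous_sum_col => i; apply: cont_mul; [exact: cont_cst|exact: coord_cts].
Qed.

Lemma sqnorm_magnetic_continuous : continuous (fun x : cV => sqnorm (A x)).
Proof.
by apply: continuous_sum_col => j; apply: cont_sqr; exact: magnetic_potential_continuous.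
Qed.

Lemma V_magnetic_continuous : continuous V.
Proof.
apply: cont_sub; last first.
  by apply: cont_mul; [exact: sqnorm_magnetic_continuous|exact: cont_cst].
apply: cont_mul; first exact: cont_cst.
apply: continuous_sum_col => j; apply: cont_mul; first exact: cont_cst.
by apply: cont_sqr; exact: coord_cts.
Qed.

Variables (phi : cV -> R) (dphi : 'I_d -> cV -> R).
Hypothesis cphi : continuous phi.
Hypothesis cdphi : forall j, continuous (dphi j).
Hypothesis dphiP : forall j x, is_derive x (e j) phi (dphi j x).
Hypothesis phi1 : supported 1 phi.
Hypothesis int_phi : (\int[mu]_x (phi x ^+ 2)%:E = 1)%E.

Let dphi1 j : supported 1 (dphi j).
Proof. exact: supported_is_derive phi1 (dphiP j). Qed.

Definition phase (a x : cV) : R := \sum_i A a i 0 * x i 0.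

Lemma phase_continuous a : continuous (phase a).
Proof.
by apply: continuous_sum_col => i; apply: cont_mul; [exact: cont_cst|exact: coord_cts].
Qed.

Lemma phase_slice a j x (s : R) : phase a (s *: e j + x) = A a j 0 * s + phase a x.
Proof.
have -> : A a j 0 * s = \sum_i A a i 0 * (s * (i == j)%:R).
  by rewrite (bigD1 j)//= eqxx mulr1 big1 ?addr0// => i /negbTE ->; rewrite !mulr0.
rewrite -big_split/=; apply: eq_bigr => i _.
by rewrite !mxE eqxx andbT mulrDr.
Qed.

Lemma is_derive_phase a j x : is_derive x (e j) (phase a) (A a j 0).
Proof.
apply/is_derive_slice0.
have -> : (fun s : R => phase a (s *: e j + x)) = (A a j 0 \*: id) + cst (phase a x).
  by apply/funext => s; rewrite phase_slice.
apply: (is_derive_eq (is_deriveD (is_deriveZ (A a j 0) (is_derive_id (0 : R) (1 : R)))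
  (is_derive_cst (phase a x) (0 : R) (1 : R)))).
by rewrite addr0; exact: mulr1.
Qed.

Lemma is_derive_comp_dir (f : cV -> R) (g : R -> R) x v (df dg : R) :
  is_derive x v f df -> is_derive (f x) 1 g dg ->
  is_derive x v (fun y => g (f y)) (dg * df).
Proof.
move=> /is_derive_slice0 hf hg; apply/is_derive_slice0.
apply: (is_derive1_comp (f := g) (g := fun s : R => f (s *: v + x))) => //.
by rewrite scale0r add0r.
Qed.

Lemma is_derive_shift_col (f : cV -> R) a x v (df : R) : is_derive (x - a) v f df ->
  is_derive x v (fun y : cV => f (y - a)) df.
Proof.
move=> /is_derive_slice0 hf; apply/is_derive_slice0.
by under eq_fun do rewrite -addrA.
Qed.

Lemma is_derive_mul (f g : cV -> R) x v (df dg : R) : is_derive x v f df ->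
  is_derive x v g dg -> is_derive x v (fun y => f y * g y) (df * g x + f x * dg).
Proof.
move=> hf hg; apply: (is_derive_eq (is_deriveM hf hg)).
by rewrite addrC; congr (_ + _); exact: mulrC.
Qed.

(* The phase turns [grad - i A] at [x] into [grad - i A] at [x - a], so that the
   magnetic kinetic energy does not depend on the centre [a]. *)
Definition trial (a x : cV) : R[i] :=
  (phi (x - a) * cos (phase a x)) +i* (phi (x - a) * sin (phase a x)).

Definition trial_partial a j (x : cV) : R[i] :=
  (dphi j (x - a) * cos (phase a x) + phi (x - a) * (- sin (phase a x) * A a j 0)) +i*
  (dphi j (x - a) * sin (phase a x) + phi (x - a) * (cos (phase a x) * A a j 0)).

Let phi_shift_continuous a : continuous (fun x : cV => phi (x - a)).
Proof. exact: cont_shift. Qed.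

Let dphi_shift_continuous a j : continuous (fun x : cV => dphi j (x - a)).
Proof. exact: cont_shift. Qed.

Let cos_phase_continuous a : continuous (fun x => cos (phase a x)).
Proof. by apply: cont_comp; [exact: phase_continuous|exact: continuous_cos]. Qed.
Let sin_phase_continuous a : continuous (fun x => sin (phase a x)).
Proof. by apply: cont_comp; [exact: phase_continuous|exact: continuous_sin]. Qed.

Lemma trial_partial_continuous a j :
  continuous (Re \o trial_partial a j) /\ continuous (Im \o trial_partial a j).
Proof.
split.
  apply: cont_add; first
    by apply: cont_mul; [exact: dphi_shift_continuous|exact: cos_phase_continuous].
  apply: cont_mul; first exact: phi_shift_continuous.
  apply: cont_mul; last exact: cont_cst.
  by move=> x; apply: continuousN; exact: sin_phase_continuous.
apply: cont_add; first
    by apply: cont_mul; [exact: dphi_shift_continuous|exact: sin_phase_continuous].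
apply: cont_mul; first exact: phi_shift_continuous.
by apply: cont_mul; [exact: cos_phase_continuous|exact: cont_cst].
Qed.

Lemma trial_continuous a : continuous (Re \o trial a) /\ continuous (Im \o trial a).
Proof.
split; apply: cont_mul; try exact: phi_shift_continuous.
  exact: cos_phase_continuous.
exact: sin_phase_continuous.
Qed.

Lemma trial_is_weak_partial a j : is_weak_partial j (trial a) (trial_partial a j).
Proof.
have [cR cI] := trial_continuous a; have [cR' cI'] := trial_partial_continuous a j.
have dS x := is_derive_phase a j x.
have dq x := is_derive_shift_col (dphiP j (x - a)).
apply: is_weak_partial_classical => // x.
  exact: (is_derive_mul (dq x) (is_derive_comp_dir (dS x) (is_derive_cos _))).
exact: (is_derive_mul (dq x) (is_derive_comp_dir (dS x) (is_derive_sin _))).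
Qed.

Lemma sqr_normc_trial a x : normc (trial a x) ^+ 2 = phi (x - a) ^+ 2.
Proof. by rewrite normc_sqrE/= !exprMn -mulrDr cos2Dsin2 mulr1. Qed.

(** The magnetic derivative is the unimodular factor [exp(i phase)] times [dphi - i A(x - a) phi],
    by linearity of [A]; with [phi] real the two terms are its real and imaginary parts. *)
Lemma sqr_normc_magnetic_trial a j x :
  normc (trial_partial a j x - 'i * (A x j 0)%:C * trial a x) ^+ 2 =
  dphi j (x - a) ^+ 2 + (A (x - a) j 0 * phi (x - a)) ^+ 2.
Proof.
rewrite normc_sqrE /= magnetic_potentialB.
set c := cos _; set s := sin _; set q := phi _; set dq := dphi _ _.
set b := A x j 0; set b' := A a j 0.
have cs : c ^+ 2 + s ^+ 2 = 1 by exact: cos2Dsin2.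
(* Once the factor [c ^+ 2 + s ^+ 2] is put back, the identity is polynomial. *)
transitivity ((c ^+ 2 + s ^+ 2) * (dq ^+ 2 + ((b - b') * q) ^+ 2)); last by rewrite cs mul1r.
ring.
Qed.

(** The finitely many directions share one null set. *)
Lemma trial_ae a : {ae mu, forall x j, weak_partial j (trial a) x = trial_partial a j x}.
Proof. by apply: filter_forall => j; apply/weak_partial_ae/trial_is_weak_partial. Qed.

Let B1 := [set y : cV | `|y| <= 1].

(** The magnetic kinetic energy density of a trial state in the variable [y = x - a]; the centre [a]
    does not enter. *)
Let kin (y : cV) : R := 2^-1 * \sum_j (dphi j y ^+ 2 + (A y j 0 * phi y) ^+ 2).

Let kin_continuous : continuous kin.
Proof.
apply: cont_mul; first exact: cont_cst.
apply: continuous_sum_col => j; apply: cont_add; apply: cont_sqr => //.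
by apply: cont_mul => //; exact: magnetic_potential_continuous.
Qed.

Let kin1 : supported 1 kin.
Proof.
move=> y y1; rewrite /kin big1 ?mulr0// => j _.
by rewrite dphi1// phi1// mulr0 expr0n addr0.
Qed.

Let shift_supported (f : cV -> R) a : supported 1 f ->
  supported (1 + `|a|) (fun x : cV => f (x - a)).
Proof.
move=> f1 x xa; apply: f1; apply: lt_le_trans (lerB_normD _ _).
by rewrite normrN ltrBrDr.
Qed.

(** The mass is that of [phi] by translation. The [Sigma] norm is finite because the weak partials
    agree almost everywhere with [trial_partial], for which the integrand [g] is continuous with
    bounded support. *)
Lemma trial_S1 a : S1 Omega gamma (trial a).
Proof.
split; last first.
  under eq_integral do rewrite sqr_normc_trial.
  rewrite -[RHS]int_phi.
  apply: (ge0_integral_shift (- a) (f := fun x => (phi x ^+ 2)%:E)).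
    by apply/measurable_EFinP; exact: (continuous_measurable_col (cont_sqr cphi)).
  by move=> x; rewrite lee_fin sqr_ge0.
have [cR cI] := trial_continuous a.
split.
- by split; exact: continuous_measurable_col.
- by move=> j; exists (trial_partial a j); exact: trial_is_weak_partial.
rewrite /Sigma_norm; apply: poweR_lty.
pose g x : R := \sum_j normc (trial_partial a j x) ^+ 2 +
  (1 + sqnorm (A x) + `|V x|) * normc (trial a x) ^+ 2.
have gE : g = fun x => \sum_j (Re (trial_partial a j x) ^+ 2 + Im (trial_partial a j x) ^+ 2)
    + (1 + sqnorm (A x) + `|V x|) * phi (x - a) ^+ 2.
  apply/funext => x; rewrite /g sqr_normc_trial; congr (_ + _).
  by apply: eq_bigr => j _; rewrite normc_sqrE.
have cg : continuous g.
  rewrite gE; apply: cont_add.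
    apply: continuous_sum_col => j; have [cR' cI'] := trial_partial_continuous a j.
    by apply: cont_add; apply: cont_sqr.
  apply: cont_mul; last by apply: cont_sqr; exact: phi_shift_continuous.
  apply: cont_add; last first.
    apply: (cont_comp V_magnetic_continuous); exact: norm_continuous.
  by apply: cont_add; [exact: cont_cst|exact: sqnorm_magnetic_continuous].
have g1 : supported (1 + `|a|) g.
  move=> x xa; have p0 := shift_supported phi1 xa.
  rewrite gE p0 expr0n mulr0 addr0 big1// => j _.
  by rewrite /= p0 (shift_supported (@dphi1 j) xa) !mul0r addr0 expr0n addr0.
have lty := integrable_lty measurableT (integrable_continuous_supported cg g1).
apply: le_lt_trans lty.
apply: ge0_ae_le_integral_sup => [x|x|].
- rewrite lee_fin addr_ge0//; first by apply: sumr_ge0 => j _; exact: sqr_ge0.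
  by rewrite mulr_ge0 ?sqr_ge0// !addr_ge0//; apply: sumr_ge0 => j _; exact: sqr_ge0.
- rewrite lee_fin addr_ge0//; first by apply: sumr_ge0 => j _; exact: sqr_ge0.
  by rewrite mulr_ge0 ?sqr_ge0// !addr_ge0//; apply: sumr_ge0 => j _; exact: sqr_ge0.
- apply: filterS (trial_ae a) => x wx; rewrite lee_fin lerD2r.
  by apply: ler_sum => j _; rewrite wx.
Qed.

Variables (N : cV -> R[i] -> R[i]) (C0 p : R).
Hypothesis C0_gt0 : 0 < C0.
Hypothesis p_ge0 : 0 <= p.
Hypothesis N_growth : forall x v, normc (N x v) <= C0 * (normc v + normc v `^ p).

(** The constant [c] collects the kinetic and nonlinear terms, which are bounded on the unit ball
    around [a] and vanish outside it; it is fixed before [a] and [W]. Since [phi ^+ 2] has integral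
    1, the [V] term contributes at most [W]. *)
Lemma energy_trial_le : exists c : R, forall (a : cV) (W : R),
  (forall y, `|y| <= 1 -> V (a + y) <= W) ->
  energy Omega gamma N (trial a) <= c + W.
Proof.
have [Kk Kk0 kinK] := continuous_supported_bounded kin_continuous kin1.
have [M M0 phiM] := continuous_supported_bounded cphi phi1.
pose G : R := 2 * (M * (C0 * (M + M `^ p))).
have CM0 : 0 <= C0 * (M + M `^ p).
  by rewrite mulr_ge0 ?(ltW C0_gt0)// addr_ge0 ?powR_ge0 ?(ltW M0).
pose K1 : R := Kk + G.
exists (Rintegral mu setT (fun y => K1 * \1_B1 y)) => a W VW.
(* [W'] bounds [|V|] on the unit ball around [a]. It may depend on [a], as it enters only the
   integrable majorant and not the final estimate. *)
have [W' W'0 VW'] := continuous_bounded_norm_le 1 (cont_shift (a := - a) V_magnetic_continuous).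
pose h (y : cV) : R := K1 * \1_B1 y + W * phi y ^+ 2.
have ii := integrable_cst_norm_le K1 1 : mu.-integrable setT (EFin \o (fun y : cV => K1 * \1_B1 y)).
have sphi2 : supported 1 (fun y => phi y ^+ 2).
  by move=> y y1; rewrite phi1// expr0n.
have iphi2 : mu.-integrable setT (EFin \o (fun y => phi y ^+ 2)).
  by apply: (integrable_continuous_supported (r := 1)) => //; exact: cont_sqr.
have iWphi2 : mu.-integrable setT (EFin \o (fun y => W * phi y ^+ 2)).
  by have := integrableZl measurableT W iphi2; apply: eq_integrable.
have ih : mu.-integrable setT (EFin \o h).
  by have := integrableD measurableT ii iWphi2; apply: eq_integrable.
have intphi2 : Rintegral mu setT (fun y => phi y ^+ 2) = 1 by rewrite /Rintegral int_phi.
have -> : Rintegral mu setT (fun y => K1 * \1_B1 y) + W =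
    Rintegral mu setT (fun x => h (x - a)).
  rewrite (integral_shift (- a) ih) [RHS]RintegralD//; congr (_ + _).
  by rewrite RintegralZl// intphi2 mulr1.
(* A common majorant for the moduli of the energy density and of the shifted [h], as
   [le_Rintegral_sup] demands. *)
pose K2 : R := K1 + (`|W| + W') * M ^+ 2.
have iK2 := integrable_shift (- a)
  (integrable_cst_norm_le K2 1 : mu.-integrable setT (EFin \o (fun y : cV => K2 * \1_B1 y))).
have E x (wx : forall j, weak_partial j (trial a) x = trial_partial a j x) :
    2^-1 * (\sum_j normc (magnetic_partial Omega j (trial a) x) ^+ 2)
    + V x * normc (trial a x) ^+ 2 + potential N x (normc (trial a x) ^+ 2) =
    kin (x - a) + V x * phi (x - a) ^+ 2 + potential N x (phi (x - a) ^+ 2).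
  rewrite sqr_normc_trial /kin; congr (_ * _ + _ + _); apply: eq_bigr => j _.
  by rewrite /magnetic_partial wx sqr_normc_magnetic_trial.
(* Taking [q = 0] and [M = 0] in the bound shows that the nonlinear term vanishes where the trial
   state does. *)
have G0 x : potential N x 0 = 0.
  have := potential_norm_le C0_gt0 p_ge0 N_growth x (q := 0) (M := 0).
  rewrite normr0 => /(_ (lexx _)); rewrite mul0r mulr0 expr0n/= => h0.
  by apply/eqP; rewrite -normr_le0.
have Gle x y : `|potential N x (phi y ^+ 2)| <= G.
  apply: le_trans (potential_norm_le C0_gt0 p_ge0 N_growth x (phiM y)) _.
  by rewrite ler_wpM2l// ler_wpM2r.
have phi2M y : phi y ^+ 2 <= M ^+ 2.
  by rewrite -(real_normK (num_real (phi y))) lerXn2r ?nnegrE ?(ltW M0).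
have out x : ~ B1 (x - a) -> phi (x - a) = 0 /\ kin (x - a) = 0.
  by move=> /negP; rewrite -ltNge => xa; rewrite phi1// kin1.
have G_ge0 : 0 <= G by rewrite mulr_ge0// mulr_ge0 ?(ltW M0).
apply: (le_Rintegral_sup iK2).
- apply: filterS (trial_ae a) => x /E ->; rewrite indicE.
  have [/set_mem xa|/negP xa] := boolP (x - a \in B1); last first.
    have [-> ->] := out _ (fun h => xa (mem_set h)).
    by rewrite expr0n mulr0 G0 !addr0 normr0 mulr0.
  rewrite mulr1 /K2 /K1 addrAC (le_trans (ler_normD _ _))// lerD//.
    rewrite (le_trans (ler_normD _ _))// lerD ?kinK//.
  rewrite normrM (ger0_norm (sqr_ge0 _)) ler_pM ?sqr_ge0//.
  by have := VW' _ xa; rewrite opprK subrK => /le_trans; apply; rewrite lerDr.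
- apply: aeW => x; rewrite /h indicE.
  have [/set_mem xa|/negP xa] := boolP (x - a \in B1); last first.
    have [-> _] := out _ (fun h => xa (mem_set h)).
    by rewrite expr0n mulr0 !mulr0 addr0 normr0.
  rewrite !mulr1 /K2 (le_trans (ler_normD _ _))// lerD//.
    by rewrite ger0_norm// addr_ge0 ?(ltW Kk0).
  rewrite normrM (ger0_norm (sqr_ge0 _)) ler_pM ?sqr_ge0// lerDl ltW//.
- apply: filterS (trial_ae a) => x /E ->; rewrite /h indicE.
  have [/set_mem xa|/negP xa] := boolP (x - a \in B1); last first.
    have [-> ->] := out _ (fun h => xa (mem_set h)).
    by rewrite expr0n !mulr0 G0 !addr0.
  rewrite mulr1 /K1 addrAC lerD//.
    rewrite lerD//; first exact: le_trans (ler_norm _) (kinK _).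
    exact: le_trans (ler_norm _) (Gle _ _).
  rewrite ler_wpM2r ?sqr_ge0//.
  by have := VW _ xa; rewrite addrC subrK.
Qed.

End TrialFunction.

(** * The potential as a quadratic form, and a direction in which it is negative *)

Section QuadraticForms.
Context {R : realType} {d : nat}.
Local Notation cV := 'cV[R]_d.
Local Notation mu := (@lebesgue_col R d).
Local Notation e j := (delta_mx j 0 : cV).

(** The expansion of a quadratic form through its polar form [Q (x + y) - Q x - Q y]. Stated as an
    identity, it passes to multiples, sums and differences by direct computation. *)
Definition quadratic (Q : cV -> R) := forall r x y,
  Q (r *: x + y) = r ^+ 2 * Q x + r * (Q (x + y) - Q x - Q y) + Q y.

Lemma quadratic_sqr (l : cV -> R) :
  (forall r x y, l (r *: x + y) = r * l x + l y) -> quadratic (fun x => l x ^+ 2).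
Proof.
move=> ll r x y; have := ll 1 x y; rewrite scale1r mul1r => ->; rewrite ll.
by ring.
Qed.

Lemma quadratic_scale (c : R) Q : quadratic Q -> quadratic (fun x => c * Q x).
Proof. by move=> qQ r x y; rewrite qQ; ring. Qed.

Lemma quadratic_sum (I : finType) (Q : I -> cV -> R) :
  (forall i, quadratic (Q i)) -> quadratic (fun x => \sum_i Q i x).
Proof.
move=> qQ r x y; rewrite -!sumrB !mulr_sumr -!big_split /=.
by apply: eq_bigr => i _; rewrite qQ.
Qed.

Lemma quadratic_sub P Q : quadratic P -> quadratic Q -> quadratic (fun x => P x - Q x).
Proof. by move=> qP qQ r x y; rewrite qP qQ; ring. Qed.

Variables (Omega : 'I_d./2 -> R) (gamma : 'I_d -> R).
Local Notation A := (magnetic_potential Omega).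
Local Notation V := (V_magnetic Omega gamma).

Lemma V_magnetic_quadratic : quadratic V.
Proof.
apply: quadratic_sub.
  apply/quadratic_scale/quadratic_sum => j; apply/quadratic_scale.
  by apply: quadratic_sqr => r x y; rewrite !mxE.
have -> : (fun x => sqnorm (A x) / 2) = (fun x => 2^-1 * \sum_j A x j 0 ^+ 2).
  by apply/funext => x; rewrite mulrC.
apply/quadratic_scale/quadratic_sum => j; apply: quadratic_sqr => r x y.
by rewrite /magnetic_potential mulmxDr -scalemxAr !mxE.
Qed.

Lemma magnetic_potential_delta i j : A (e i) j 0 = rotation_mx Omega j i.
Proof. by rewrite /magnetic_potential -colE mxE. Qed.

Lemma rotation_mx_fst k : rotation_mx Omega (block_snd k) (block_fst k) = Omega k.
Proof.
rewrite /rotation_mx summxE (bigD1 k)//= big1 ?addr0 => [|l lk]; rewrite !mxE.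
  rewrite !eqxx/= (_ : (block_snd k == block_fst k) = false) ?subr0 ?mulr1//.
  by apply/negbTE; rewrite -val_eqE/= -addn1 -[eqbRHS]addn0 eqn_add2l.
rewrite -!val_eqE/= (_ : (k.*2 == l.*2) = false) ?andbF; last first.
  by apply/negbTE; rewrite -!muln2 eqn_mul2r/= eq_sym.
rewrite (_ : (k.*2.+1 == l.*2) = false) ?subr0 ?mulr0//.
by apply/eqP => /(congr1 odd); rewrite /= !odd_double.
Qed.

Lemma rotation_mx_anti i j : rotation_mx Omega j i = - rotation_mx Omega i j.
Proof.
rewrite /rotation_mx !summxE -sumrN; apply: eq_bigr => k _; rewrite !mxE.
by rewrite -mulrN opprB ![(i == _) && _]andbC.
Qed.

(** The squared norm of [A (e i)] is the sum of squares over column [i] of the rotation matrix; only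
    the entry in row [j] is kept. *)
Lemma V_magnetic_delta i j : V (e i) <=
  (Num.sg (gamma i) * gamma i ^+ 2 - rotation_mx Omega j i ^+ 2) / 2.
Proof.
rewrite /V_magnetic /V_gamma mulrBl lerB//.
  rewrite mulrC (bigD1 i)//= big1 => [|k /negbTE ki]; last first.
    by rewrite mxE ki expr0n mulr0.
  by rewrite mxE !eqxx expr1n mulr1 addr0.
rewrite ler_pM2r ?invr_gt0// /sqnorm (bigD1 j)//= magnetic_potential_delta lerDl.
by apply: sumr_ge0 => k _; exact: sqr_ge0.
Qed.

(** A negative [gamma j] makes [V (e j)] negative directly. Otherwise take the coordinate of block
    [k] whose [gamma] is nonnegative and below [|Omega k|]: the matrix entry linking it to its
    partner is plus or minus [Omega k], whose square exceeds that of [gamma]. *)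
Lemma V_magnetic_direction_lt0 :
  ((exists k : 'I_d./2,
      `|Omega k| > Num.min (gamma (block_fst k)) (gamma (block_snd k)))
   \/ (exists j : 'I_d, gamma j < 0)) ->
  exists i, V (e i) < 0.
Proof.
have neg j : gamma j < 0 -> exists i, V (e i) < 0.
  move=> gj; exists j; apply: le_lt_trans (V_magnetic_delta j j) _.
  rewrite ltr0_sg// mulN1r pmulr_llt0 ?invr_gt0//.
  have := sqr_ge0 (rotation_mx Omega j j).
  have : 0 < gamma j ^+ 2 by rewrite exprn_even_gt0//= lt_eqF.
  lra.
have pos i j : rotation_mx Omega j i ^+ 2 > gamma i ^+ 2 -> 0 <= gamma i -> V (e i) < 0.
  move=> gi gi0; apply: le_lt_trans (V_magnetic_delta i j) _.
  rewrite pmulr_llt0 ?invr_gt0// subr_lt0; apply: le_lt_trans gi.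
  by rewrite ler_piMl ?sqr_ge0// sgr_def ltNge gi0; case: (_ != _).
case=> [[k]|[j gj]]; last exact: neg gj.
have sq g : g < `|Omega k| -> 0 <= g -> g ^+ 2 < Omega k ^+ 2.
  by move=> gO g0; rewrite -(real_normK (num_real (Omega k))) ltrXn2r ?nnegrE.
rewrite gt_min => /orP[] gk.
  have [g0|g0] := ltP (gamma (block_fst k)) 0; first exact: neg g0.
  by exists (block_fst k); apply: (pos _ (block_snd k)) => //; rewrite rotation_mx_fst sq.
have [g0|g0] := ltP (gamma (block_snd k)) 0; first exact: neg g0.
exists (block_snd k); apply: (pos _ (block_fst k)) => //.
by rewrite rotation_mx_anti sqrrN rotation_mx_fst sq.
Qed.

(** [C] bounds [|V|] on the ball of radius 2, which contains [e i], [y] and [e i + y]; the polar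
    form is then at most [3 * C]. *)
Lemma V_magnetic_translate i : exists2 C : R, 0 < C &
  forall r y, 0 <= r -> `|y| <= 1 -> V (r *: e i + y) <= r ^+ 2 * V (e i) + 3 * C * r + C.
Proof.
have [C C0 VC] := continuous_bounded_norm_le 2 (@V_magnetic_continuous R d Omega gamma).
exists C => // r y r0 y1; rewrite V_magnetic_quadratic.
have e1 := norm_delta_le1 (R := R) i.
have h1 : `|V (e i + y)| <= C.
  by apply: VC; rewrite (le_trans (ler_normD _ _))// (le_trans (lerD e1 y1)).
have h2 : `|V (e i)| <= C by apply: VC; rewrite (le_trans e1)// ler1n.
have h3 : `|V y| <= C by apply: VC; rewrite (le_trans y1)// ler1n.
have h : V (e i + y) - V (e i) - V y <= 3 * C.
  by move: h1 h2 h3; rewrite !ler_norml => /andP[? ?] /andP[? ?] /andP[? ?]; lra.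
rewrite lerD ?(le_trans (ler_norm _) h3)// lerD2l mulrC ler_wpM2r//.
Qed.

(** A smooth bump on the box with sides []-1, 1[], which is the open unit ball of the maximum norm,
    is divided by the square root of its mass. *)
Lemma unit_mass_profile : exists (phi : cV -> R) (dphi : 'I_d -> cV -> R),
  [/\ continuous phi, (forall j, continuous (dphi j)),
      (forall j x, is_derive x (e j) phi (dphi j x)), supported 1 phi &
      (\int[mu]_x (phi x ^+ 2)%:E = 1)%E].
Proof.
pose b : cV -> R := box_bump 1 (fun=> -1) (fun=> 1).
have [sb _] : test_function b by exact: box_bump_test_function.
have cb := smooth_continuous sb.
have b1 : supported 1 b by apply: box_bump_supported.
have cb2 := cont_sqr cb.
have b21 : supported 1 (fun x => b x ^+ 2) by move=> x x1; rewrite b1// expr0n.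
have ib2 := integrable_continuous_supported cb2 b21.
have fb2 := integrable_fin_num measurableT ib2.
have mb2 : measurable_fun setT (EFin \o (fun x => b x ^+ 2)).
  by apply/measurable_EFinP; exact: continuous_measurable_col.
pose m := fine (\int[mu]_x (b x ^+ 2)%:E)%E.
have mE : (\int[mu]_x (b x ^+ 2)%:E = m%:E)%E by rewrite fineK.
(* With zero mass [b] would vanish almost everywhere, but it is positive on a box of positive
   measure. *)
have m0 : 0 < m.
  rewrite lt_neqAle fine_ge0 ?andbT; last first.
    by apply: integral_ge0 => x _; rewrite lee_fin sqr_ge0.
  apply/eqP => m0; move: mE; rewrite -m0 => int0.
  have : ae_eq mu setT (EFin \o (fun x => b x ^+ 2)) (cst 0%E).
    apply/(ae_eq_integral_abs mu measurableT mb2).1; rewrite -[RHS]int0.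
    by apply: eq_integral => x _ /=; rewrite ger0_norm// sqr_ge0.
  move=> [E [mE' E0 bE]].
  pose D : set cV := obox (fun=> -1) (fun=> 1).
  have : (0 < mu D)%E by apply: lebesgue_obox_gt0 => i; lra.
  rewrite ltNge => /negP; apply; rewrite -E0 le_measure ?inE//; first exact: measurable_obox.
  move=> x xb; apply: bE => /= /(_ I) [] /eqP; apply/negP.
  by rewrite expf_neq0// gt_eqF// prodr_gt0// => i _; exact: itv_bump_gt0.
pose c : R := (Num.sqrt m)^-1.
exists (fun x => c * b x), (fun j x => c * partial j b x); split.
- by apply: cont_mul; [exact: cont_cst|exact: cb].
- by move=> j; apply: cont_mul; [exact: cont_cst|exact: smooth_partial_continuous].
- by move=> j x; exact: (is_deriveZ c (smooth_is_derive j x sb)).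
- by move=> x x1; rewrite b1// mulr0.
under eq_integral do rewrite exprMn EFinM.
rewrite integralZl// mE -EFinM exprVn sqr_sqrtr ?(ltW m0)// mulVf//.
by rewrite gt_eqF.
Qed.

End QuadraticForms.

(** * Trial energies along a coordinate ray fall below any given value *)

Unset Implicit Arguments.

Theorem theorem1p3 (R : realType) (d : nat) (p : R)
    (Omega : 'I_d./2 -> R) (gamma : 'I_d -> R)
    (N : 'cV[R]_d -> R[i] -> R[i]) (C0 : R)
    (d_ge2 : (2 <= d)%N)
    (p_ge1 : 1 <= p)
    (p_subcritical : (2 < d)%N -> p < 1 + 4 / (d - 2)%:R)
    (N_continuous :
      continuous (fun z : 'cV[R]_d * R[i]^o => N z.1 z.2 : R[i]^o))
    (C0_gt0 : 0 < C0)
    (N_growth : forall x v, normc (N x v) <= C0 * (normc v + normc v `^ p))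
    (G_real : potential_real N)
    (N_potential : derives_from_potential N)
    (instability :
      (exists k : 'I_d./2,
         `|Omega k| > Num.min (gamma (block_fst k)) (gamma (block_snd k)))
      \/ (exists j : 'I_d, gamma j < 0)) :
  ~ exists u : 'cV[R]_d -> R[i], ground_state Omega gamma N u.
Proof.
have [i Vi] := V_magnetic_direction_lt0 instability.
have [phi [dphi [cphi cdphi dphiP phi1 int_phi]]] := @unit_mass_profile R d.
have p_ge0 : 0 <= p by exact: le_trans p_ge1.
have [c energy_le] := energy_trial_le Omega gamma cphi cdphi dphiP phi1 int_phi
  C0_gt0 p_ge0 N_growth.
have [C C_gt0 V_le] := V_magnetic_translate Omega gamma i.
move=> [u [_ uI1]]; pose t := energy Omega gamma N u.
(* Chosen so that [c + C - L <= - |t| - 1 < t], where [t] is the energy of the supposed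
   minimiser. *)
pose L : R := `|c| + C + `|t| + 1.
pose k : R := - V_magnetic Omega gamma (delta_mx i 0).
have k0 : 0 < k by rewrite oppr_gt0.
have L0 : 0 < L by rewrite ltr_wpDl// !addr_ge0// ltW.
(* With this choice [r * k = k + 3 * C + L], so the quadratic term [- r ^+ 2 * k] cancels the linear
   term [3 * C * r] and leaves [- r * k - r * L], which is at most [- L] because [r >= 1]. *)
pose r : R := 1 + (3 * C + L) / k.
have r1 : 1 <= r by rewrite lerDl divr_ge0 ?(ltW k0)// addr_ge0 ?(ltW L0)// mulr_ge0// ltW.
pose a : 'cV[R]_d := r *: delta_mx i 0.
have lt_t : energy Omega gamma N (trial Omega phi a) < t.
  have r0 : 0 <= r by exact: le_trans r1.
  apply: le_lt_trans (energy_le a _ (fun y y1 => V_le r y r0 y1)) _.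
  have rk : r * k = k + (3 * C + L) by rewrite mulrDl mul1r divfK// gt_eqF.
  have rrk : r ^+ 2 * V_magnetic Omega gamma (delta_mx i 0) =
      - (r * k + 3 * C * r + r * L).
    transitivity (- (r * (k + (3 * C + L)))); first by rewrite -rk /k; ring.
    by ring.
  have rL : L <= r * L by rewrite ler_peMl// ltW.
  have rk0 : 0 <= r * k by rewrite mulr_ge0// ltW.
  have cc := ler_norm c; have tt := ler_norm (- t); rewrite normrN in tt.
  have CL : L = `|c| + C + `|t| + 1 by [].
  rewrite rrk; lra.
have : (I1 Omega gamma N <= (energy Omega gamma N (trial Omega phi a))%:E)%E.
  apply: ereal_inf_lbound; exists (trial Omega phi a) => //.
  exact: (trial_S1 Omega gamma cphi cdphi dphiP phi1 int_phi).
by rewrite -uI1 lee_fin leNgt lt_t.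
Qed.
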